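(* Let $g=(g_1,\dots,g_m)$ be a tuple of polynomials in $\mathbb R[x]$, $x=(x_1,\dots,x_n)$, let $S=\{x\in\mathbb R^n:g_j(x)\ge0,\ j=1,\dots,m\}$, and let $f\in\mathbb R[x]$ with $f\ge0$ on $S$. Let (Q) be the problem of minimizing $f(x)$ subject to $g_j(x)\ge0$, $j=1,\dots,m$. Then: (i) Suppose $S$ is closed at $\infty$ and the degrees of $f,g_1,\dots,g_m$ are even. If the LICQC, SCC and SOSC hold at every minimizer of (Q), including every minimizer at infinity, then $(1+\|x\|^2)^kf\in\mathrm{QM}[g]$ for some $k\in\mathbb N$. (ii) If the form $f^{(1)}$ is positive definite in $\mathbb R^n$ and the LICQC, SCC and SOSC hold at every minimizer of (Q), then $(1+\|x\|^2)^kf\in\mathrm{QM}[g]$ for some $k\in\mathbb N$.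
   Context: ''Minimizer'' means global minimizer. $f_{\min}=\inf_Sf$, $d=\deg f$. $f^{(1)}$ is the homogeneous part of $f$ of highest degree; a form $p$ is positive definite if $p(x)>0$ for all nonzero $x\in\mathbb R^n$. $\mathrm{QM}[g]=\Sigma[x]+g_1\Sigma[x]+\cdots+g_m\Sigma[x]$, with $\Sigma[x]$ the set of sums of squares of polynomials. **Homogenization.** $\tilde x=(x_0,x)\in\mathbb R^{n+1}$; $\tilde p(\tilde x)=x_0^{\deg p}p(x/x_0)$. $S$ (with its given description) is closed at $\infty$ if the closure of $\{\tilde x:\tilde g_j(\tilde x)\ge0\ (j=1,\dots,m),\ x_0>0\}$ equals $\{\tilde x:\tilde g_j(\tilde x)\ge0\ (j=1,\dots,m),\ x_0\ge0\}$. A point $x^*\in\mathbb R^n$ is a minimizer at infinity of (Q) if $\tilde x^*=(0,x^* )$ satisfies $\|\tilde x^*\|=1$, $\tilde g_j(\tilde x^* )\ge0$ for all $j$, and $\tilde f(\tilde x^* )-f_{\min}\cdot(\tilde x_0^* )^d=0$. In part (i) (all degrees even), the LICQC, SCC and SOSC are said to hold at a minimizer at infinity $x^*$ if they hold at $(0,x^* )$ for the problem $$\min\ \tilde f(\tilde x)-f_{\min}x_0^d\quad\text{s.t.}\quad\tilde g_1(\tilde x)\ge0,\dots,\tilde g_m(\tilde x)\ge0,\quad\|\tilde x\|^2-1=0.$$ **Optimality conditions.** For a problem $\min\phi(u)$ s.t. $h_i(u)=0\ (i\in E)$, $h_j(u)\ge0\ (j\in I)$ and a local minimizer $u^*$,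 let $J(u^* )=\{i\in E\cup I: h_i(u^* )=0\}$. LICQC: the gradients $\nabla h_i(u^* )$, $i\in J(u^* )$, are linearly independent. Under LICQC there are unique multipliers $\lambda_i$ with $\nabla\phi(u^* )=\sum_{i\in E\cup I}\lambda_i\nabla h_i(u^* )$, $\lambda_j\ge0$ and $\lambda_jh_j(u^* )=0$ for $j\in I$. SCC: $\lambda_j+h_j(u^* )>0$ for all $j\in I$. SOSC: $v^T\nabla^2\mathscr L(u^* )v>0$ for all $v\ne0$ orthogonal to all $\nabla h_i(u^* )$, $i\in J(u^* )$, where $\mathscr L=\phi-\sum_i\lambda_ih_i$. *)

(* Defs.v *)
From HB Require Import structures.
From mathcomp Require Import all_boot all_order all_algebra.
From mathcomp Require Import mpoly.
From mathcomp Require Import classical_sets reals topology normedtype.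

Set Implicit Arguments.
Unset Strict Implicit.
Unset Printing Implicit Defensive.

Import Order.TTheory GRing.Theory Num.Theory.
Import numFieldNormedType.Exports.

Local Open Scope ring_scope.
Local Open Scope classical_set_scope.

(* A point of R^n is a row vector [x : 'rV[R]_n]; the value of [p] at [x] is
   [p.@[x 0]], since [x 0 : 'I_n -> R] is the family of coordinates of [x]. *)

(* [deg 0 = 0], as [msize 0 = 0]. *)
Definition deg (R : realType) (n : nat) (p : {mpoly R[n]}) : nat := (msize p).-1.

Definition leading_form (R : realType) (n : nat) (p : {mpoly R[n]}) :
    {mpoly R[n]} :=
  pihomog mdeg (deg p) p.

Definition positive_definite (R : realType) (n : nat) (p : {mpoly R[n]}) : Prop :=
  forall x : 'rV[R]_n, x != 0 -> 0 < p.@[x 0].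

Definition sqnorm (R : realType) (n : nat) : {mpoly R[n]} := \sum_i 'X_i ^+ 2.

(* The library norm [`|x|] of a row vector is the sup norm. *)
Definition enorm (R : realType) (n : nat) (x : 'rV[R]_n) : R :=
  Num.sqrt (\sum_i x 0 i ^+ 2).

Definition sos (R : realType) (n : nat) (p : {mpoly R[n]}) : Prop :=
  exists s : seq {mpoly R[n]}, p = \sum_(q <- s) q ^+ 2.

Definition QM (R : realType) (n m : nat) (g : m.-tuple {mpoly R[n]}) :
    set {mpoly R[n]} :=
  [set p | exists (s0 : {mpoly R[n]}) (s : 'I_m -> {mpoly R[n]}),
     [/\ sos s0, forall j, sos (s j) & p = s0 + \sum_j tnth g j * s j]].

Definition basic_semialg (R : realType) (n m : nat) (g : m.-tuple {mpoly R[n]}) :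
    set 'rV[R]_n :=
  [set x | forall j, 0 <= (tnth g j).@[x 0]].

(* Polynomial optimization problems: minimize [objective] subject to
   [h = 0] for [h] in [eqs] and [h >= 0] for [h] in [ineqs]. *)

Record poly_problem (R : realType) (n p m : nat) := PolyProblem {
  objective : {mpoly R[n]};
  eqs : p.-tuple {mpoly R[n]};
  ineqs : m.-tuple {mpoly R[n]} }.

Definition feasible (R : realType) (n p m : nat) (P : poly_problem R n p m) :
    set 'rV[R]_n :=
  [set u | (forall i, (tnth (eqs P) i).@[u 0] = 0) /\
           (forall j, 0 <= (tnth (ineqs P) j).@[u 0])].

Definition minimizer (R : realType) (n p m : nat) (P : poly_problem R n p m)
    (u : 'rV[R]_n) : Prop :=
  feasible P u /\
  forall v, feasible P v -> (objective P).@[u 0] <= (objective P).@[v 0].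

Definition grad (R : realType) (n : nat) (p : {mpoly R[n]}) (u : 'rV[R]_n) :
    'rV[R]_n :=
  \row_i (p^`M(i)).@[u 0].

Definition hessian (R : realType) (n : nat) (p : {mpoly R[n]}) (u : 'rV[R]_n) :
    'M[R]_n :=
  \matrix_(i, j) (p^`M(i)^`M(j)).@[u 0].

Definition active (R : realType) (n p m : nat) (P : poly_problem R n p m)
    (u : 'rV[R]_n) : seq {mpoly R[n]} :=
  [seq h <- eqs P ++ ineqs P | h.@[u 0] == 0].

Definition LICQC (R : realType) (n p m : nat) (P : poly_problem R n p m)
    (u : 'rV[R]_n) : Prop :=
  free [seq grad h u | h <- active P u].

Definition lagrangian (R : realType) (n p m : nat) (P : poly_problem R n p m)
    (mu : 'I_p -> R) (la : 'I_m -> R) : {mpoly R[n]} :=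
  objective P - (\sum_i mu i *: tnth (eqs P) i + \sum_j la j *: tnth (ineqs P) j).

Definition multipliers (R : realType) (n p m : nat) (P : poly_problem R n p m)
    (u : 'rV[R]_n) (mu : 'I_p -> R) (la : 'I_m -> R) : Prop :=
  [/\ grad (objective P) u =
        \sum_i mu i *: grad (tnth (eqs P) i) u +
        \sum_j la j *: grad (tnth (ineqs P) j) u,
      forall j, 0 <= la j
    & forall j, la j * (tnth (ineqs P) j).@[u 0] = 0].

(* [SCC] and [SOSC] speak about "the" multipliers at [u]: these exist and are
   unique at a minimizer satisfying [LICQC]. *)
Definition SCC (R : realType) (n p m : nat) (P : poly_problem R n p m)
    (u : 'rV[R]_n) : Prop :=
  exists (mu : 'I_p -> R) (la : 'I_m -> R), multipliers P u mu la /\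
    forall j, 0 < la j + (tnth (ineqs P) j).@[u 0].

Definition SOSC (R : realType) (n p m : nat) (P : poly_problem R n p m)
    (u : 'rV[R]_n) : Prop :=
  exists (mu : 'I_p -> R) (la : 'I_m -> R), multipliers P u mu la /\
    forall v : 'rV[R]_n, v != 0 ->
      (forall h, h \in active P u -> (v *m (grad h u)^T) 0 0 = 0) ->
      0 < (v *m hessian (lagrangian P mu la) u *m v^T) 0 0.

Definition optimality_conditions (R : realType) (n p m : nat)
    (P : poly_problem R n p m) (u : 'rV[R]_n) : Prop :=
  [/\ LICQC P u, SCC P u & SOSC P u].

Definition problemQ (R : realType) (n m : nat) (f : {mpoly R[n]})
    (g : m.-tuple {mpoly R[n]}) : poly_problem R n 0 m :=
  PolyProblem f [tuple] g.

(* [inf] returns 0 on the empty set; this value only enters the homogenized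
   problem, and an empty feasible set is closed at infinity only if some
   constraint is a negative constant. *)
Definition fmin (R : realType) (n m : nat) (f : {mpoly R[n]})
    (g : m.-tuple {mpoly R[n]}) : R :=
  inf [set f.@[x 0] | x in basic_semialg g].

(* Homogenization: the variable x_0 is ['X_ord0] and x_i is
   ['X_(lift ord0 i)]; see [homogenizeE] and [homogenize_dhomog]. *)

Definition hpt (R : realType) (n : nat) (x0 : R) (x : 'rV[R]_n) : 'rV[R]_n.+1 :=
  row_mx (const_mx x0 : 'rV[R]_1) x.

Definition homogenize (R : realType) (n : nat) (p : {mpoly R[n]}) :
    {mpoly R[n.+1]} :=
  \sum_(a <- msupp p)
    p@_a *: ('X_ord0 ^+ (deg p - mdeg a) * \prod_i 'X_(lift ord0 i) ^+ a i).

Definition homogenize_tuple (R : realType) (n m : nat)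
    (g : m.-tuple {mpoly R[n]}) : m.-tuple {mpoly R[n.+1]} :=
  [tuple homogenize (tnth g j) | j < m].

Definition closed_at_infinity (R : realType) (n m : nat)
    (g : m.-tuple {mpoly R[n]}) : Prop :=
  closure (basic_semialg (homogenize_tuple g) `&`
           [set u : 'rV[R]_n.+1 | 0 < u 0 ord0]) =
  basic_semialg (homogenize_tuple g) `&`
    [set u : 'rV[R]_n.+1 | 0 <= u 0 ord0].

Definition homogenized_problem (R : realType) (n m : nat) (f : {mpoly R[n]})
    (g : m.-tuple {mpoly R[n]}) : poly_problem R n.+1 1 m :=
  PolyProblem (homogenize f - fmin f g *: 'X_ord0 ^+ deg f)
    [tuple sqnorm R n.+1 - 1] (homogenize_tuple g).

Definition minimizer_at_infinity (R : realType) (n m : nat) (f : {mpoly R[n]})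
    (g : m.-tuple {mpoly R[n]}) (x : 'rV[R]_n) : Prop :=
  let u := hpt 0 x in
  [/\ enorm u = 1,
      forall j, 0 <= (homogenize (tnth g j)).@[u 0]
    & (homogenize f).@[u 0] - fmin f g * u 0 ord0 ^+ deg f = 0].

Lemma hpt0 (R : realType) (n : nat) (x0 : R) (x : 'rV[R]_n) :
  hpt x0 x 0 ord0 = x0.
Proof.
have -> : ord0 = lshift n (@ord0 0) by apply/val_inj.
by apply: etrans (row_mxEl _ _ _ _) _; rewrite mxE.
Qed.

Lemma hptS (R : realType) (n : nat) (x0 : R) (x : 'rV[R]_n) (i : 'I_n) :
  hpt x0 x 0 (lift ord0 i) = x 0 i.
Proof.
have -> : lift ord0 i = rshift 1 i by apply/val_inj.
exact: row_mxEr.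
Qed.

Lemma homogenizeE (R : realType) (n : nat) (p : {mpoly R[n]}) (x0 : R)
    (x : 'rV[R]_n) : x0 != 0 ->
  (homogenize p).@[hpt x0 x 0] = x0 ^+ deg p * p.@[(x0^-1 *: x) 0].
Proof.
move=> x0N0; rewrite raddf_sum mevalE mulr_sumr /= big_seq [RHS]big_seq.
apply: eq_bigr => a /msize_mdeg_lt a_lt.
rewrite mevalZ mevalM rmorphXn /= mevalXU hpt0 rmorph_prod /=.
rewrite [RHS]mulrCA; congr (p@_a * _).
under eq_bigr do rewrite rmorphXn /= mevalXU hptS.
under [in RHS]eq_bigr do rewrite mxE exprMn.
rewrite big_split /= -expr_sum -mdegE exprVn mulrA; congr (_ * _).
by rewrite -expfB_cond ?(negPf x0N0) // /deg; case: (msize p) a_lt.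
Qed.

Lemma homogenize_dhomog (R : realType) (n : nat) (p : {mpoly R[n]}) :
  homogenize p \is (deg p).-homog.
Proof.
rewrite /homogenize big_seq; apply: rpred_sum => a /msize_mdeg_lt a_lt.
apply: rpredZ; have ale : (mdeg a <= deg p)%N by rewrite /deg; case: (msize p) a_lt.
have := subnK ale; set e := (deg p - mdeg a)%N => <-.
have homX i k : ('X_i : {mpoly R[n.+1]}) ^+ k \is k.-homog.
  rewrite -[X in X.-homog]mul1n; apply: dhomogMn.
  by rewrite dhomogX /= mdeg1.
apply: dhomogM; first exact: homX.
rewrite mdegE; elim/big_rec2: _ => [|i k q _ hq]; first exact: dhomog1.
exact: dhomogM.
Qed.

(* Main.v *)
(* Homogenize: on the unit sphere of R^(n+1) put F = f~ - fmin x0^d and let G_j be g~_j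
   (part (i)) or x0^(deg g_j) g~_j (part (ii)), all forms of even degree. Then F >= 0 on
   K = {G >= 0} within the sphere, and it suffices to show that F lies in QM[G] + (|x|^2 - 1):
   substituting (1, x) / r with r = ± sqrt (1 + |x|^2), averaging over the sign and clearing
   denominators gives (1 + |x|^2)^k (f - fmin) in QM[g].

   At a zero z of F on K, LICQC, SCC and SOSC give m in QM[G] + (|x|^2 - 1) and c > 0 with
   F - m - c |x - z|^2 in the cube of the maximal ideal of z: the multipliers are perturbed to
   first order so that the Lagrangian's Hessian, positive on the tangent space, becomes
   positive definite (Finsler). So zeros are isolated, and by the Chinese remainder theorem
   the local certificates glue: F = m + c q + (cubic remainder), where q is the product of
   the |x - z|^2 over the finitely many zeros. Damping by powers of 1 - eps q makes the
   remainder small away from the zeros, so that F splits into terms whose multipliers are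
   strictly positive on K, and Putinar's theorem applies to each of them.

   Putinar's theorem on the sphere is proved by removing the constraints one at a time,
   f - l g (1 - g / M)^(2k), then making f positive on the cube [-1, 1]^(n+1) by adding a
   multiple of (|x|^2 - 1)^2, and finally using the Bernstein form, since
   2 (1 ± x_i) = (1 ± x_i)^2 + \sum_(j != i) x_j^2 on the sphere. *)
Require Import Defs.
From mathcomp Require Import all_boot all_order all_algebra.
From mathcomp Require Import mpoly.
From mathcomp Require Import ring lra zify.
From mathcomp Require Import classical_sets boolp reals topology normedtype.
From mathcomp Require derive.

Set Implicit Arguments.
Unset Strict Implicit.
Unset Printing Implicit Defensive.

Import Order.TTheory GRing.Theory Num.Theory.
Import numFieldNormedType.Exports.

Local Open Scope ring_scope.

(** * Polynomials and powers of maximal ideals *)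

(** Induction adapted to ring morphisms and derivations: monomials are built one variable at a time,
    so a product rule for ['X_i] suffices. *)
Lemma mpoly_ind_ring (R : realType) (n : nat) (P : {mpoly R[n]} -> Prop) :
  (forall c, P c%:MP) -> (forall p q, P p -> P q -> P (p + q)) ->
  (forall i p, P p -> P ('X_i * p)) -> forall p, P p.
Proof.
move=> PC PD PX; elim/mpolyind => [|c a p _ _ Pp]; first by rewrite -mpolyC0.
apply: PD => //; rewrite mpolyXE_id -mul_mpolyC mulrC.
elim/big_rec: _ => [|i q _ Pq]; first by rewrite mul1r.
rewrite -mulrA; elim: (a i) => [|k IH]; first by rewrite expr0 mul1r.
by rewrite exprS -mulrA; apply: PX.
Qed.

(* The restriction of [p] to the line [x + t e_i] is a univariate polynomial. *)
Lemma meval0_mderiv (R : realType) (n : nat) (p : {mpoly R[n]}) (i : 'I_n) :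
  (forall x : 'I_n -> R, p.@[x] = 0) -> forall x : 'I_n -> R, p^`M(i).@[x] = 0.
Proof.
move=> p0 x.
pose l j : {poly R} := (x j)%:P + (i == j)%:R%:P * 'X.
pose phi := mmap (@polyC R) l.
have phiM q1 q2 : phi (q1 * q2) = phi q1 * phi q2 by apply: rmorphM.
have phiD q1 q2 : phi (q1 + q2) = phi q1 + phi q2 by apply: mmapD.
have phiC c : phi c%:MP = c%:P by apply: mmapC.
have phiX j : phi 'X_j = l j by rewrite /phi mmapX mmap1U.
have phiE q t : (phi q).[t] = q.@[fun j => x j + (i == j)%:R * t].
  elim/mpoly_ind_ring: q => [c|q1 q2 IH1 IH2|j q IH].
  - by rewrite phiC hornerC mevalC.
  - by rewrite phiD hornerD mevalD IH1 IH2.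
  - by rewrite phiM phiX hornerM mevalM IH mevalXU /l !hornerE.
have phi'E q : (phi q)^`().[0] = q^`M(i).@[x].
  elim/mpoly_ind_ring: q => [c|q1 q2 IH1 IH2|j q IH].
  - by rewrite phiC derivC horner0 mderivC meval0.
  - by rewrite phiD derivD hornerD mderivD mevalD IH1 IH2.
  - rewrite phiM derivM hornerD !hornerM IH phiX phiE mderivM mevalD !mevalM.
    rewrite mevalXU /l derivD derivC derivM derivC derivX !hornerE.
    rewrite mderivX mevalZ mnm1E [j == i]eq_sym.
    rewrite (meval_eq q (v2 := x)) => [|k]; last by rewrite mulr0 addr0.
    congr (_ * _ + _); case: eqP => [->|_]; last by rewrite mul0r.
    rewrite (_ : (U_(j) - U_(j))%MM = 0%MM) ?mpolyX0 ?meval1 ?mulr1 //.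
    by apply/mnmP => k; rewrite mnmBE subnn mnmE.
rewrite -phi'E (_ : phi p = 0) ?deriv0 ?horner0 //.
apply/eqP; apply/negPn/negP => phi_n0.
(* A nonzero [phi p] would have as many roots as its size, namely the integers below
   [size (phi p)]. *)
pose s := [seq k%:R : R | k <- iota 0 (size (phi p))].
suff : (size s < size (phi p))%N by rewrite size_map size_iota ltnn.
apply: max_poly_roots phi_n0 _ _; last first.
  by rewrite map_inj_uniq ?iota_uniq // => a b /eqP; rewrite eqr_nat => /eqP.
by apply/allP => t _; rewrite /root phiE p0.
Qed.

(** In characteristic 0 the values determine the coefficients: all iterated derivatives vanish
    identically, and at the origin they are the coefficients times nonzero products of
    factorials. *)
Lemma meval_inj (R : realType) (n : nat) (p q : {mpoly R[n]}) :
  (forall x : 'rV[R]_n, p.@[x 0] = q.@[x 0]) -> p = q.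
Proof.
move=> pq; apply/eqP; rewrite -subr_eq0; apply/eqP.
have : forall x, (p - q).@[x] = 0.
  move=> x; have := pq (\row_i x i); rewrite mevalB.
  rewrite !(@meval_eq _ _ ((\row_i x i) 0) x) => [-> |i|i]; rewrite ?mxE //.
  by rewrite subrr.
move: (p - q) => {pq q}{}p p0.
apply/mpolyP => m; rewrite mcoeff0.
have : (p^`M[m]).@[fun=> 0] = 0.
  rewrite mderivm_foldr; set s := flatten _; move: (fun=> 0).
  elim: s => [|i s IH] x /=; first exact: p0.
  exact: meval0_mderiv.
move: (mcoeff_mderivm m p 0%MM); rewrite addm0 => cm.
have -> : (p^`M[m]).@[fun=> 0] = (p^`M[m])@_0.
  elim/mpoly_ind_ring: (p^`M[m]) => [c|q1 q2 IH1 IH2|i q IH].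
  - by rewrite mevalC mcoeffC eqxx mulr1.
  - by rewrite mevalD IH1 IH2 mcoeffD.
  - by rewrite mevalM mevalXU mul0r (rmorphM (mcoeff 0%MM)) /= mcoeffX mnm1_eq0 mul0r.
rewrite cm => /eqP; rewrite mulrn_eq0 => /orP[|/eqP //].
rewrite -leqn0 leqNgt prodn_gt0 // => i; rewrite ffact_gt0 //.
Qed.

Lemma mderiv_sum (R : realType) (n : nat) (I : Type) (s : seq I) (P : pred I)
    (F : I -> {mpoly R[n]}) (i : 'I_n) :
  (\sum_(k <- s | P k) F k)^`M(i) = \sum_(k <- s | P k) (F k)^`M(i).
Proof. exact: (raddf_sum (mderiv i)). Qed.

Lemma meval_sum (R : realType) (n : nat) (I : Type) (s : seq I) (P : pred I)
    (F : I -> {mpoly R[n]}) (x : 'I_n -> R) :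
  (\sum_(k <- s | P k) F k).@[x] = \sum_(k <- s | P k) (F k).@[x].
Proof. exact: (raddf_sum (meval x)). Qed.

Section PowersOfMaximalIdeals.
Variables (R : realType) (n : nat).
Implicit Types (p q r : {mpoly R[n]}) (z : 'rV[R]_n) (zs : seq 'rV[R]_n).

Definition shift z i : {mpoly R[n]} := 'X_i - (z 0 i)%:MP.

(* Membership in the [k]-th power of the maximal ideal of [z]. *)
Fixpoint vanish z k p : Prop :=
  if k is k'.+1 then
    exists a : 'I_n -> {mpoly R[n]},
      (forall i, vanish z k' (a i)) /\ p = \sum_i a i * shift z i
  else True.

Lemma vanish0 z k : vanish z k 0.
Proof.
elim: k => //= k IH; exists (fun=> 0); split=> //.
by rewrite big1 // => i _; rewrite mul0r.
Qed.

Lemma vanishD z k p q : vanish z k p -> vanish z k q -> vanish z k (p + q).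
Proof.
elim: k p q => //= k IH p q [a [az ->]] [b [bz ->]].
exists (fun i => a i + b i); split=> [i|]; first exact: IH.
by rewrite -big_split; apply: eq_bigr => i _; rewrite mulrDl.
Qed.

Lemma vanishMl z k p q : vanish z k q -> vanish z k (p * q).
Proof.
elim: k p q => //= k IH p q [b [bz ->]].
exists (fun i => p * b i); split=> [i|]; first exact: IH.
by rewrite mulr_sumr; apply: eq_bigr => i _; rewrite mulrA.
Qed.

Lemma vanishMr z k p q : vanish z k p -> vanish z k (p * q).
Proof. by move=> ?; rewrite mulrC; apply: vanishMl. Qed.

Lemma vanishN z k p : vanish z k p -> vanish z k (- p).
Proof. by rewrite -mulN1r; apply: vanishMl. Qed.

Lemma vanishB z k p q : vanish z k p -> vanish z k q -> vanish z k (p - q).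
Proof. by move=> ? /vanishN; apply: vanishD. Qed.

Lemma vanish_sum z k (I : Type) (s : seq I) (P : pred I) (F : I -> {mpoly R[n]}) :
  (forall i, P i -> vanish z k (F i)) -> vanish z k (\sum_(i <- s | P i) F i).
Proof.
move=> PF; elim/big_ind: _ => //; first exact: vanish0.
by move=> p q; apply: vanishD.
Qed.

Lemma vanishM z k l p q :
  vanish z k p -> vanish z l q -> vanish z (k + l) (p * q).
Proof.
elim: k p => [|k IH] p; first by move=> _; apply: vanishMl.
move=> /= [a [az ->]] qz; exists (fun i => a i * q); split=> [i|].
  exact: IH.
by rewrite mulr_suml; apply: eq_bigr => i _; ring.
Qed.

Lemma vanish_shift z i : vanish z 1 (shift z i).
Proof.
exists (fun j => (j == i)%:R); split=> //.
rewrite (bigD1 i) //= eqxx mul1r big1 ?addr0 // => j /negPf ->.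
by rewrite mul0r.
Qed.

Arguments vanish : simpl never.

Lemma vanishW z k p : vanish z k.+1 p -> vanish z k p.
Proof.
case=> [a [az ->]]; apply: vanish_sum => i _; exact: vanishMr (az i).
Qed.

(** The induction rests on [x_i p - z_i p(z) = p (x_i - z_i) + z_i (p - p(z))]. *)
Lemma vanish_root z p : p.@[z 0] = 0 <-> vanish z 1 p.
Proof.
split=> [pz|[a [_ ->]]]; last first.
  rewrite raddf_sum big1 //= => i _.
  by rewrite mevalM mevalB mevalXU mevalC subrr mulr0.
suff : vanish z 1 (p - p.@[z 0]%:MP) by rewrite pz mpolyC0 subr0.
elim/mpoly_ind_ring: p {pz} => [c|p q IHp IHq|i p IH].
- by rewrite mevalC subrr; apply: vanish0.
- rewrite mevalD mpolyCD.
  have -> : p + q - (p.@[z 0]%:MP + q.@[z 0]%:MP) =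
    (p - p.@[z 0]%:MP) + (q - q.@[z 0]%:MP) by ring.
  exact: vanishD.
- rewrite mevalM mevalXU mpolyCM.
  have -> : 'X_i * p - (z 0 i)%:MP * (p.@[z 0])%:MP =
    p * shift z i + (z 0 i)%:MP * (p - (p.@[z 0])%:MP) by rewrite /shift; ring.
  by apply: vanishD; apply: vanishMl => //; apply: vanish_shift.
Qed.

Lemma vanish1C z p : vanish z 1 (p - p.@[z 0]%:MP).
Proof. by apply/vanish_root; rewrite mevalB mevalC subrr. Qed.

Definition linear_jet z p : {mpoly R[n]} := \sum_i (p^`M(i).@[z 0])%:MP * shift z i.

Definition quadratic_form z (H : 'M[R]_n) : {mpoly R[n]} :=
  \sum_i \sum_j (H i j)%:MP * shift z i * shift z j.

Lemma mderiv_shift z i j : (shift z i)^`M(j) = (i == j)%:R.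
Proof.
rewrite /shift mderivB mderivC subr0 mderivX mnm1E; case: eqP => [->|_].
  rewrite scale1r (_ : (U_(j) - U_(j))%MM = 0%MM) ?mpolyX0 //.
  by apply/mnmP => k; rewrite mnmBE subnn mnmE.
by rewrite scale0r.
Qed.

Lemma meval_shift z i (x : 'rV[R]_n) : (shift z i).@[x 0] = x 0 i - z 0 i.
Proof. by rewrite mevalB mevalXU mevalC. Qed.

(** In [p - p(z) = \sum_i a_i (x_i - z_i)], differentiation at [z] gives [a_i(z) = d_i p(z)], so
    replacing [a_i] by this constant costs only order 2. *)
Lemma taylor1 z p : vanish z 2 (p - p.@[z 0]%:MP - linear_jet z p).
Proof.
have [a [_ pa]] := vanish1C z p.
rewrite pa /linear_jet -sumrB; apply: vanish_sum => i _.
rewrite -mulrBl -[2%N]/(1 + 1)%N; apply: vanishM; last exact: vanish_shift.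
suff -> : p^`M(i).@[z 0] = (a i).@[z 0] by apply: vanish1C.
have -> : p = p.@[z 0]%:MP + \sum_i a i * shift z i by rewrite -pa addrC subrK.
rewrite mderivD mderivC add0r mderiv_sum meval_sum (bigD1 i) //= big1 => [|j ji].
  by rewrite mderivM mevalD !mevalM mderiv_shift eqxx meval_shift meval1; ring.
rewrite mderivM mevalD !mevalM mderiv_shift (negPf ji) meval_shift meval0.
by ring.
Qed.

(** As the [a i] vanish at [z], a term survives only if one derivative falls on [a i] and the other
    on the linear factor. *)
Lemma hessian_pow1 z (a : 'I_n -> {mpoly R[n]}) k l :
  (forall i, (a i).@[z 0] = 0) ->
  ((\sum_i a i * shift z i)^`M(k)^`M(l)).@[z 0] =
  ((a l)^`M(k)).@[z 0] + ((a k)^`M(l)).@[z 0].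
Proof.
move=> az; rewrite (mderiv_sum _ _ (fun i => a i * shift z i)).
rewrite (mderiv_sum _ _ (fun i => (a i * shift z i)^`M(k))) meval_sum.
pose F (i : 'I_n) : R := (i == l)%:R * ((a i)^`M(k)).@[z 0] +
  (i == k)%:R * ((a i)^`M(l)).@[z 0].
rewrite (eq_bigr F) => [|i _].
  rewrite /F big_split /=; congr (_ + _).
    by rewrite (bigD1 l) //= eqxx mul1r big1 ?addr0 // => j /negPf ->; rewrite mul0r.
  by rewrite (bigD1 k) //= eqxx mul1r big1 ?addr0 // => j /negPf ->; rewrite mul0r.
rewrite mderivM mderivD !mderivM !mderiv_shift !mevalD !mevalM !meval_shift az.
rewrite /F; have nat0 (b : bool) : (b%:R : {mpoly R[n]})^`M(l) = 0.
  by case: b; rewrite ?mderiv0 // -mpolyC1 mderivC.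
have natE (b : bool) : (b%:R : {mpoly R[n]}).@[z 0] = b%:R.
  by case: b; rewrite ?meval1 ?meval0.
by rewrite nat0 !natE meval0; ring.
Qed.

Lemma taylor2 z p :
  p.@[z 0] = 0 -> grad p z = 0 ->
  vanish z 3 (p - quadratic_form z (2^-1 *: hessian p z)).
Proof.
move=> pz gz.
have : vanish z 2 p.
  have := taylor1 z p; rewrite pz mpolyC0 subr0 /linear_jet big1 ?subr0 // => i _.
  by move/rowP/(_ i): gz; rewrite !mxE => ->; rewrite mpolyC0 mul0r.
case=> [a [av pE]]; have az i : (a i).@[z 0] = 0 by apply/vanish_root/av.
have -> : quadratic_form z (2^-1 *: hessian p z) = \sum_i linear_jet z (a i) * shift z i.
  rewrite /quadratic_form; pose F i j : {mpoly R[n]} :=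
    (2^-1)%:MP * ((a j)^`M(i)).@[z 0]%:MP * shift z i * shift z j.
  (* The Hessian symmetrizes the matrix of first derivatives of the [a i]; after exchanging the
     summations its two halves coincide. *)
  transitivity (\sum_i \sum_j (F i j + F j i)).
    apply: eq_bigr => i _; apply: eq_bigr => j _; rewrite !mxE pE hessian_pow1 //.
    by rewrite mpolyCM mpolyCD /F; ring.
  under eq_bigr do rewrite big_split /=.
  rewrite big_split /= [X in X + _]exchange_big /= -big_split /=.
  apply: eq_bigr => j _; rewrite /linear_jet mulr_suml -big_split /=.
  apply: eq_bigr => i _; rewrite /F.
  have half : (2^-1)%:MP + (2^-1)%:MP = 1 :> {mpoly R[n]}.
    by rewrite -mpolyCD -mpolyC1; congr _%:MP; rewrite [RHS]splitr mul1r.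
  by rewrite -[RHS]mul1r -half; ring.
rewrite pE -sumrB; apply: vanish_sum => i _.
rewrite -mulrBl; apply: (@vanishM _ 2 1); last exact: vanish_shift.
by have := taylor1 z (a i); rewrite az mpolyC0 subr0.
Qed.

End PowersOfMaximalIdeals.

Arguments vanish : simpl never.

Local Open Scope classical_set_scope.

(** * Compact sets *)

Lemma meval_continuous (R : realType) (n : nat) (p : {mpoly R[n]}) :
  continuous (fun x : 'rV[R]_n => p.@[x 0]).
Proof.
elim/mpoly_ind_ring: p => [c|p q cp cq|i p cp] x.
- rewrite (_ : (fun _ => _) = fun=> c); first exact: cst_continuous.
  by apply/funext => y; rewrite mevalC.
- rewrite (_ : (fun _ => _) = (fun y : 'rV_n => p.@[y 0]) \+ (fun y => q.@[y 0])).
    exact: continuousD (cp x) (cq x).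
  by apply/funext => y; rewrite mevalD.
- rewrite (_ : (fun _ => _) = (fun y : 'rV_n => y 0 i) \* (fun y => p.@[y 0])); last first.
    by apply/funext => y; rewrite mevalM mevalXU.
  exact: continuousM (@coord_continuous _ _ _ 0 i x) (cp x).
Qed.

(** Bernoulli's inequality, multiplied out; the step is [(1 - t) (1 + (N + 1) t) <= 1 + N t]. It
    gives decay of order [1 / N] with an explicit threshold. *)
Lemma bernoulli_decay (R : realType) (w t : R) (N : nat) :
  0 <= w -> 0 <= t -> w <= 1 - t -> w ^+ N * (1 + N%:R * t) <= 1.
Proof.
move=> w0 t0 wt; elim: N => [|N IH]; first by rewrite expr0; lra.
apply: le_trans IH; rewrite exprSr -mulrA ler_wpM2l ?exprn_ge0 //.
have N0 : 0 <= N%:R :> R by [].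
apply: le_trans (_ : (1 - t) * (1 + N.+1%:R * t) <= _).
  by rewrite ler_wpM2r // addr_ge0 // mulr_ge0.
rewrite -natr1; have : 0 <= (N%:R + 1) * t ^+ 2 by rewrite mulr_ge0 ?sqr_ge0 ?addr_ge0.
by rewrite expr2; lra.
Qed.

Section CompactSets.
Variables (R : realType) (T : topologicalType).
Implicit Types (X : set T) (f : T -> R).

Lemma compact_lower_bound X f : compact X -> continuous f ->
  (forall x, X x -> 0 < f x) -> exists2 d, 0 < d & forall x, X x -> d < f x.
Proof.
move=> cX cf f_gt0.
have [[x0 Xx0]|X0] := pselect (X !=set0); last first.
  by exists 1 => // x Xx; case: X0; exists x.
have [||c /set_mem Xc cmin] := @derive.compact_EVT_min _ _ f _ _ cX.
- by exists x0.
- exact: continuous_subspaceT.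
exists (f c / 2); first by rewrite divr_gt0 ?f_gt0.
move=> x Xx; apply: lt_le_trans (cmin x (mem_set Xx)).
by have := f_gt0 c Xc; lra.
Qed.

Lemma compact_upper_bound X f : compact X -> continuous f ->
  exists2 C, 0 < C & forall x, X x -> `|f x| <= C.
Proof.
move=> cX cf.
have [[x0 Xx0]|X0] := pselect (X !=set0); last first.
  by exists 1 => // x Xx; case: X0; exists x.
have [||c /set_mem Xc cmax] := @derive.compact_EVT_max _ _ (fun x => `|f x|) _ _ cX.
- by exists x0.
- by apply: continuous_subspaceT => x; apply: continuous_comp (cf x) (@norm_continuous _ _ _).
exists (`|f c| + 1); first by rewrite ltr_wpDl.
by move=> x Xx; rewrite ler_wpDr // cmax // mem_set.
Qed.

(** Where [a <= 0], compactness gives [b > d > 0] and [a >= - C], so [k = C / d] suffices; elsewhere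
    the penalty does no harm. *)
Lemma compact_penalty X (a b : T -> R) : compact X -> continuous a -> continuous b ->
  (forall x, X x -> 0 <= b x) -> (forall x, X x -> b x = 0 -> 0 < a x) ->
  exists2 k, 0 < k & forall x, X x -> 0 < a x + k * b x.
Proof.
move=> cX ca cb b_ge0 a_gt0.
pose Y := X `&` [set x | a x <= 0].
have cY : compact Y.
  apply: compact_closedI => //.
  by apply: closed_comp (@closed_le _ 0) => x _; apply: ca.
have [d d0 dY] : exists2 d, 0 < d & forall x, Y x -> d < b x.
  apply: compact_lower_bound => // x [Xx ax]; rewrite lt_def b_ge0 // andbT.
  by apply/eqP => /(a_gt0 x Xx); rewrite ltNge ax.
have [C C0 aC] := compact_upper_bound cX ca.
exists (C / d); first exact: divr_gt0.
move=> x Xx; have [ax|ax] := ltP 0 (a x).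
  by rewrite ltr_pwDl // mulr_ge0 ?b_ge0 // divr_ge0 ?ltW.
have : C < C / d * b x.
  rewrite -mulrA ltr_pMr // mulrC ltr_pdivlMr // mul1r.
  exact: dY.
by have := aC x Xx; rewrite ler_norml => /andP[]; lra.
Qed.

(** Where [p >= d], the weight [w] stays away from 1 and its powers decay uniformly; where [p < d],
    the factor [w^N <= 1] keeps the product below [d]. *)
Lemma compact_power_small X (p w : T -> R) (d : R) : compact X ->
  continuous p -> continuous w -> 0 < d ->
  (forall x, X x -> 0 <= w x <= 1) -> (forall x, X x -> w x = 1 -> p x <= 0) ->
  exists N0, forall N, (N0 <= N)%N -> forall x, X x -> p x * w x ^+ N < d.
Proof.
move=> cX cp cw d0 w01 p_le0.
pose Y := X `&` [set x | d <= p x].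
have cY : compact Y.
  apply: compact_closedI => //.
  by apply: closed_comp (@closed_ge _ d) => x _; apply: cp.
have [e e0 eY] : exists2 e, 0 < e & forall x, Y x -> e < 1 - w x.
  apply: compact_lower_bound => //.
    by move=> x; apply: cvgB; [apply: cst_continuous|apply: cw].
  move=> x [Xx px]; rewrite subr_gt0 lt_neqAle; case/andP: (w01 x Xx) => _ ->.
  by rewrite andbT; apply/eqP => /(p_le0 x Xx); rewrite leNgt (lt_le_trans d0 px).
have [C C0 pC] := compact_upper_bound cX cp.
(* This threshold makes [C <= N d e], hence [p w^N <= d (N e w^N) <= d (1 - w^N) < d] by
   [bernoulli_decay], unless [w^N = 0]. *)
have [N0 /ltW HN0] : exists N, C / (d * e) < N%:R :> R.
  by exists (Num.truncn (C / (d * e))).+1; apply: truncnS_gt.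
exists N0 => N lN x Xx; have /andP[w0 w1] := w01 x Xx.
have [xd|xd] := ltP (p x) d.
  have [px|px] := leP (p x) 0.
    by apply: le_lt_trans d0; rewrite mulr_le0_ge0 // exprn_ge0.
  by apply: le_lt_trans xd; rewrite ler_piMr ?exprn_ile1 // ltW.
have pxC : p x <= C by apply: le_trans (pC x Xx); apply: ler_norm.
have we : w x <= 1 - e by have := eY x (conj Xx xd); lra.
have := bernoulli_decay N w0 (ltW e0) we.
have Ne : C <= N%:R * (d * e).
  rewrite -ler_pdivrMr ?mulr_gt0 //; apply: le_trans HN0 _.
  by rewrite ler_nat.
set W := w x ^+ N => WN; have W0 : 0 <= W by apply: exprn_ge0.
have [->|Wn0] := eqVneq W 0; first by rewrite mulr0.
have {Wn0} W0' : 0 < W by rewrite lt_def Wn0.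
have : p x * W <= C * W by rewrite ler_wpM2r.
have : C * W <= N%:R * (d * e) * W by rewrite ler_wpM2r.
have := ler_wpM2l (ltW d0) WN.
have : 0 < d * W by apply: mulr_gt0.
by rewrite mulr1 mulrDr mulrDr mulr1; move=> *; nra.
Qed.
End CompactSets.

(** * Bernstein form *)

(** Expansion of [t^a] in the Bernstein basis of degree [D], multiplied by [D ^_ a] to avoid
    division; the induction step is [(k + 1) C(D + 1, k + 1) = (D + 1) C(D, k)]. *)
Lemma bernstein_power (A : comNzRingType) (t s : A) (D a : nat) :
  t + s = 1 ->
  t ^+ a *+ (D ^_ a) =
    \sum_(k < D.+1) (t ^+ k * s ^+ (D - k)) *+ ('C(D, k) * k ^_ a).
Proof.
move=> ts; elim: a D => [|a IH] D.
  rewrite expr0 ffactn0 mulr1n -(expr1n _ D) -ts addrC exprDn.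
  by apply: eq_bigr => k _; rewrite ffactn0 muln1 mulrC.
rewrite big_ord_recl ffact0n muln0 mulr0n add0r.
case: D => [|D]; first by rewrite big_ord0 ffact0n mulr0n.
rewrite ffactSS mulnC mulrnA exprS.
rewrite -mulrnAr IH mulr_sumr -sumrMnl; apply: eq_bigr => k _ /=.
rewrite /bump /= add1n subSS ffactSS exprS.
have -> : ('C(D.+1, k.+1) * (k.+1 * k ^_ a) = 'C(D, k) * k ^_ a * D.+1)%N.
  by rewrite mulnA (mulnC _ k.+1) -mul_bin_diag /=; lia.
by rewrite !(mulrnA, mulrnAr) !mulrA.
Qed.

(** Compares one factor of [ffact_ratio] with [k / D], uniformly in [k]. The subtraction [k - a] is
    truncated, so [k <= a] is a case of its own. *)
Lemma ffact_ratio_step (R : realType) (D a k : nat) : (a < D)%N -> (k <= D)%N ->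
  `|(k - a)%:R / (D - a)%:R - k%:R / D%:R| <= a%:R / (D - a)%:R :> R.
Proof.
move=> aD kD; have Da : 0 < (D - a)%:R :> R by rewrite ltr0n subn_gt0.
have D0 : 0 < D%:R :> R by rewrite ltr0n (leq_ltn_trans _ aD).
have DaE : (D - a)%:R = D%:R - a%:R :> R by rewrite natrB // ltnW.
have a0 : 0 <= a%:R :> R by []. have k0 : 0 <= k%:R :> R by [].
have kD' : k%:R <= D%:R :> R by rewrite ler_nat.
rewrite -(ler_pM2r Da) divfK ?gt_eqF // -[X in `|_| * X <= _](gtr0_norm Da) -normrM.
rewrite mulrBl divfK ?gt_eqF // mulrAC DaE.
have E : k%:R * (D%:R - a%:R) / D%:R = k%:R - a%:R * (k%:R / D%:R) :> R.
  by field; rewrite gt_eqF.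
rewrite E.
have r1 : 0 <= k%:R / D%:R :> R /\ k%:R / D%:R <= 1 :> R.
  by rewrite divr_ge0 //= ler_pdivrMr // mul1r.
have := mulr_ge0 a0 (proj1 r1).
have : a%:R * (k%:R / D%:R) <= a%:R :> R by rewrite ler_piMr //; case: r1.
have [ka|/ltnW ka] := leqP k a; last by rewrite natrB // ler_norml; lra.
rewrite (eqP (_ : (k - a == 0)%N)) ?subn_eq0 //.
have : k%:R <= a%:R :> R by rewrite ler_nat.
rewrite -E -DaE => *; rewrite sub0r normrN ger0_norm ?divr_ge0 ?mulr_ge0 //.
rewrite ler_pdivrMr // DaE.
by nra.
Qed.

(** The Bernstein coefficient of [t^a] at the node [k / D]; it tends to [(k / D)^a]. *)
Definition ffact_ratio (R : realType) (D a k : nat) : R := (k ^_ a)%:R / (D ^_ a)%:R.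

Lemma ffact_ratio01 (R : realType) (D a k : nat) : (k <= D)%N ->
  0 <= ffact_ratio R D a k <= 1.
Proof.
move=> kD; rewrite divr_ge0 //=.
(* For [a > D] the denominator is 0, and so is the quotient. *)
have [Da|Da] := posnP (D ^_ a); first by rewrite /ffact_ratio Da invr0 mulr0.
rewrite ler_pdivrMr ?ltr0n // mul1r ler_nat.
elim: a {Da} => [|a IH]; first by rewrite !ffactn0.
by rewrite !ffactnSr leq_mul // leq_sub2r.
Qed.

Lemma distM01 (R : realType) (x y x' y' : R) : 0 <= x <= 1 -> 0 <= y' <= 1 ->
  `|x * y - x' * y'| <= `|x - x'| + `|y - y'|.
Proof.
move=> /andP[x0 x1] /andP[y0 y1].
have -> : x * y - x' * y' = y' * (x - x') + x * (y - y') by ring.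
apply: le_trans (ler_normD _ _) _; rewrite !normrM (ger0_norm x0) (ger0_norm y0).
by apply: lerD; rewrite ler_piMl.
Qed.

Lemma ffact_ratio_cvg (R : realType) (a : nat) (e : R) : 0 < e ->
  exists D0, forall D, (D0 <= D)%N -> forall k, (k <= D)%N ->
    `|ffact_ratio R D a k - (k%:R / D%:R) ^+ a| < e.
Proof.
elim: a e => [|a IH] e e0.
  by exists 0%N => D _ k _; rewrite /ffact_ratio !ffactn0 expr0 divr1 subrr normr0.
have e20 : 0 < e / 2 by rewrite divr_gt0.
have [D0 HD0] := IH _ e20.
(* The second bound ensures [a / (D - a) < e / 2]. *)
exists (maxn D0 (a + (Num.truncn (a%:R / (e / 2))).+1)) => D.
rewrite geq_max => /andP[/HD0{}HD0 DN] k kD.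
have aD : (a < D)%N by lia.
have Da : 0 < (D - a)%:R :> R by rewrite ltr0n subn_gt0.
have -> : ffact_ratio R D a.+1 k = ffact_ratio R D a k * ((k - a)%:R / (D - a)%:R).
  by rewrite /ffact_ratio !ffactnSr !natrM invfM; ring.
rewrite exprSr; apply: le_lt_trans (distM01 _ _ _ _) _.
- exact: ffact_ratio01.
- by rewrite divr_ge0 //= ler_pdivrMr ?mul1r ?ler_nat // ltr0n (leq_ltn_trans _ aD).
rewrite [e]splitr; apply: ltrD; first exact: HD0.
apply: le_lt_trans (ffact_ratio_step R aD kD) _.
rewrite ltr_pdivrMr // mulrC -ltr_pdivrMr //.
apply: lt_le_trans (truncnS_gt _) _; rewrite ler_nat.
by rewrite -(leq_add2l a) subnKC // ltnW.
Qed.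

Lemma dist_prod01 (R : realType) (n : nat) (x y : 'I_n -> R) :
  (forall i, 0 <= x i <= 1) -> (forall i, 0 <= y i <= 1) ->
  `|\prod_i x i - \prod_i y i| <= \sum_i `|x i - y i|.
Proof.
move=> x01 y01; suff : [/\ 0 <= \prod_i x i <= 1, 0 <= \prod_i y i <= 1 &
  `|\prod_i x i - \prod_i y i| <= \sum_i `|x i - y i|] by case.
elim/big_rec3: _ => [|i u v w _ [/andP[u0 u1] /andP[v0 v1] IH]].
  by rewrite subrr normr0 lexx ler01.
have /andP[xi0 xi1] := x01 i; have /andP[yi0 yi1] := y01 i.
split; rewrite ?mulr_ge0 ?mulr_ile1 //.
by apply: le_trans (distM01 _ _ _ _) _; rewrite ?xi0 ?v0 // lerD2l.
Qed.

Lemma eventually_all (T : eqType) (s : seq T) (P : T -> nat -> Prop) :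
  (forall x, x \in s -> exists N0, forall N, (N0 <= N)%N -> P x N) ->
  exists N0, forall N, (N0 <= N)%N -> forall x, x \in s -> P x N.
Proof.
elim: s => [|y s IH] Ps; first by exists 0%N.
have [N1 HN1] := Ps y (mem_head _ _).
have [x xs|N2 HN2] := IH; first by apply: Ps; rewrite inE xs orbT.
exists (maxn N1 N2) => N; rewrite geq_max => /andP[N1N N2N] x.
by rewrite inE => /predU1P[->|]; [apply: HN1|apply: HN2].
Qed.

Section Bernstein.
Variables (R : realType) (n : nat).
Implicit Types p : {mpoly R[n]}.

(** Barycentric coordinates of the interval [[-1, 1]]. *)
Definition upper_coord i : {mpoly R[n]} := (2^-1)%:MP * (1 + 'X_i).
Definition lower_coord i : {mpoly R[n]} := (2^-1)%:MP * (1 - 'X_i).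

Lemma coordD i : upper_coord i + lower_coord i = 1.
Proof.
rewrite -mulrDr; have -> : 1 + 'X_i + (1 - 'X_i) = 2%:MP :> {mpoly R[n]}.
  by rewrite mpolyC_nat; ring.
by rewrite -mpolyCM mulVf ?pnatr_eq0.
Qed.

Definition bernstein_basis (D : nat) (k : {ffun 'I_n -> 'I_D.+1}) : {mpoly R[n]} :=
  \prod_i ('C(D, k i)%:R * (upper_coord i ^+ k i * lower_coord i ^+ (D - k i))).

Lemma bernstein_monomial (D : nat) (a : 'X_{1..n}) : (forall i, (a i <= D)%N) ->
  \prod_i upper_coord i ^+ a i =
  \sum_(k : {ffun 'I_n -> 'I_D.+1})
    (\prod_i ffact_ratio R D (a i) (k i))%:MP * bernstein_basis k.
Proof.
move=> aD; rewrite (eq_bigr (fun i => \sum_(k < D.+1)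
  (ffact_ratio R D (a i) k)%:MP *
  ('C(D, k)%:R * (upper_coord i ^+ k * lower_coord i ^+ (D - k))))) => [|i _].
  rewrite bigA_distr_bigA /=; apply: eq_bigr => k _.
  by rewrite big_split /= rmorph_prod.
have DN0 : (D ^_ a i)%:R != 0 :> R by rewrite pnatr_eq0 -lt0n ffact_gt0.
transitivity ((D ^_ a i)%:R^-1%:MP * (upper_coord i ^+ a i *+ D ^_ a i)).
  by rewrite -[X in _ = _ * X]mulr_natl mulrA -mpolyC_nat -mpolyCM mulVf // mpolyC1 mul1r.
rewrite (bernstein_power _ _ (coordD i)) mulr_sumr; apply: eq_bigr => k _.
rewrite /ffact_ratio mpolyCM mpolyC_nat -[_ *+ (_ * _)]mulr_natl natrM.
by ring.
Qed.

(* With many nodes the Bernstein coefficients are close to the values at the nodes. *)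
Lemma bernstein_positive p :
  (forall x : 'rV[R]_n, (forall i, `|x 0 i| <= 1) -> 0 < p.@[x 0]) ->
  exists (D : nat) (c : {ffun 'I_n -> 'I_D.+1} -> R),
    (forall k, 0 <= c k) /\ p = \sum_k (c k)%:MP * bernstein_basis k.
Proof.
move=> p_gt0.
(* [q] is [p] written in the coordinates [u_i = (1 + x_i) / 2], that is, with [x_i = 2 u_i - 1]. *)
pose q := p \mPo [tuple (2%:MP * 'X_i - 1 : {mpoly R[n]}) | i < n].
have pq : p = \sum_(a <- msupp q) (q@_a)%:MP * \prod_i upper_coord i ^+ a i.
  transitivity (q \mPo [tuple upper_coord i | i < n]).
    apply: meval_inj => x; rewrite !comp_mpoly_meval; apply: meval_eq => i.
    rewrite tnth_mktuple !(mevalB, mevalM, mevalC, meval1, mevalXU) tnth_mktuple.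
    by rewrite mevalM mevalC mevalD meval1 mevalXU; field.
  rewrite comp_mpolyE; apply: eq_bigr => a _; rewrite mul_mpolyC.
  by congr (_ *: _); apply: eq_bigr => i _; rewrite tnth_mktuple.
pose box := [set x : 'rV[R]_n | forall i, `[-1, 1]%classic (x ord0 i)]%classic.
have [|||d d0 dp] := @compact_lower_bound R _ box (fun x => p.@[x 0]).
- by apply: (@rV_compact R n (fun=> `[-1, 1]%classic)) => i; apply: segment_compact.
- exact: meval_continuous.
- move=> x xb; apply: p_gt0 => i.
  by have := xb i; rewrite /= in_itv /= ler_norml.
(* Each of the [n] factors of a monomial will contribute an error below [d / (C + 1)], so that the
   total error is at most [d]. *)
pose C := \sum_(a <- msupp q) `|q@_a| * n%:R.
have C0 : 0 <= C by apply: sumr_ge0 => a _; rewrite mulr_ge0.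
have C1 : 0 < C + 1 by rewrite ltr_wpDl.
have [b _|D0 HD0] := @eventually_all _ (iota 0 (msize q)) (fun a D => forall k, (k <= D)%N ->
    `|ffact_ratio R D a k - (k%:R / D%:R) ^+ a| < d / (C + 1)).
  by apply: ffact_ratio_cvg; rewrite divr_gt0.
pose D := maxn (maxn D0 1) (msize q).
have D_gt0 : 0 < D%:R :> R by rewrite ltr0n /D; lia.
have small a : a \in msupp q -> forall i, (a i < msize q)%N.
  move=> /msize_mdeg_lt aq i; apply: leq_ltn_trans aq.
  by rewrite mdegE (bigD1 i) //= leq_addr.
exists D, (fun k : {ffun 'I_n -> 'I_D.+1} =>
  \sum_(a <- msupp q) q@_a * \prod_i ffact_ratio R D (a i) (k i)).
split=> [k|]; last first.
  rewrite {1}pq; under [RHS]eq_bigr do rewrite rmorph_sum mulr_suml /=.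
  rewrite exchange_big /= big_seq [RHS]big_seq; apply: eq_bigr => a /small aq.
  rewrite (@bernstein_monomial D) => [|i]; last first.
    by rewrite /D (leq_trans (ltnW (aq i))) // leq_maxr.
  by rewrite mulr_sumr; apply: eq_bigr => k _; rewrite mpolyCM mulrA.
(* The grid point of index [k]: the coefficient is [p(x)] plus an error of absolute value at most
   [d < p(x)]. *)
pose x : 'rV[R]_n := \row_i (2 * ((k i : nat)%:R / D%:R) - 1).
have k01 i : 0 <= (k i : nat)%:R / D%:R :> R /\ (k i : nat)%:R / D%:R <= 1 :> R.
  by rewrite divr_ge0 //= ler_pdivrMr // mul1r ler_nat -ltnS ltn_ord.
have xb : box x.
  by move=> i; rewrite /= in_itv /= mxE; have := k01 i; lra.
have -> : \sum_(a <- msupp q) q@_a * \prod_i ffact_ratio R D (a i) (k i) =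
  p.@[x 0] + \sum_(a <- msupp q) q@_a * (\prod_i ffact_ratio R D (a i) (k i)
    - \prod_i ((k i : nat)%:R / D%:R) ^+ a i).
  under [X in _ + X]eq_bigr do rewrite mulrBr.
  rewrite sumrB addrC -addrA -[LHS]addr0; congr (_ + _).
  rewrite pq meval_sum; apply/eqP; rewrite eq_sym addrC subr_eq0; apply/eqP.
  apply: eq_bigr => a _; rewrite mevalM mevalC rmorph_prod /=; congr (_ * _).
  apply: eq_bigr => i _; rewrite rmorphXn /= mevalM mevalC mevalD meval1 mevalXU mxE.
  by congr (_ ^+ _); field; rewrite gt_eqF.
set E := \sum_(a <- _) _; suff : `|E| <= d.
  by have := dp x xb; rewrite ler_norml => + /andP[]; lra.
apply: le_trans (_ : C * (d / (C + 1)) <= d); last first.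
  by rewrite mulrCA ler_piMr ?ltW // ltr_pdivrMr // mul1r ltrDl.
rewrite mulr_suml; apply: le_trans (ler_norm_sum _ _ _) _.
rewrite big_seq [leRHS]big_seq; apply: ler_sum => a /small aq.
rewrite normrM -mulrA ler_wpM2l //.
apply: le_trans (dist_prod01 _ _) _ => [i|i|].
- by apply: ffact_ratio01; rewrite -ltnS ltn_ord.
- by rewrite exprn_ge0 ?exprn_ile1 //; case: (k01 i).
apply: (@le_trans _ _ (\sum_(i < n) d / (C + 1))); last first.
  by rewrite sumr_const card_ord mulr_natl.
apply: ler_sum => i _.
apply/ltW/HD0; first by rewrite /D; lia.
  by rewrite mem_iota add0n /= aq.
by rewrite -ltnS ltn_ord.
Qed.

End Bernstein.

(** * Putinar's Positivstellensatz on the sphere *)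

Section SumsOfSquares.
Variables (R : realType) (n : nat).
Implicit Types p q s : {mpoly R[n]}.

Lemma sos0 : sos (0 : {mpoly R[n]}).
Proof. by exists [::]; rewrite big_nil. Qed.

Lemma sos_sqr p : sos (p ^+ 2).
Proof. by exists [:: p]; rewrite big_seq1. Qed.

Lemma sosD p q : sos p -> sos q -> sos (p + q).
Proof. by move=> [s ->] [t ->]; exists (s ++ t); rewrite big_cat. Qed.

Lemma sosM p q : sos p -> sos q -> sos (p * q).
Proof.
move=> [s ->] [t ->]; exists [seq a * b | a <- s, b <- t].
rewrite big_allpairs_dep mulr_suml; apply: eq_bigr => a _; rewrite mulr_sumr.
by apply: eq_bigr => b _; rewrite exprMn.
Qed.

Lemma sosC (c : R) : 0 <= c -> sos (c%:MP : {mpoly R[n]}).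
Proof.
by move=> c0; exists [:: (Num.sqrt c)%:MP]; rewrite big_seq1 -rmorphXn /= sqr_sqrtr.
Qed.

Lemma sos_nat k : sos (k%:R : {mpoly R[n]}).
Proof. by rewrite -mpolyC_nat; apply: sosC. Qed.

Lemma sos1 : sos (1 : {mpoly R[n]}).
Proof. exact: (sos_nat 1). Qed.

Lemma sosX p k : sos p -> sos (p ^+ k).
Proof.
move=> sp; elim: k => [|k IH]; first by rewrite expr0; apply: sos1.
by rewrite exprS; apply: sosM.
Qed.

Lemma sos_sum (I : Type) (r : seq I) (P : pred I) (F : I -> {mpoly R[n]}) :
  (forall i, P i -> sos (F i)) -> sos (\sum_(i <- r | P i) F i).
Proof. by move=> sF; elim/big_ind: _ => //; [apply: sos0|apply: sosD]. Qed.

Lemma sos_prod (I : Type) (r : seq I) (P : pred I) (F : I -> {mpoly R[n]}) :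
  (forall i, P i -> sos (F i)) -> sos (\prod_(i <- r | P i) F i).
Proof. by move=> sF; elim/big_ind: _ => //; [apply: sos1|apply: sosM]. Qed.

Lemma sos_ge0 p (x : 'I_n -> R) : sos p -> 0 <= p.@[x].
Proof.
by move=> [s ->]; rewrite meval_sum; apply: sumr_ge0 => q _; rewrite rmorphXn sqr_ge0.
Qed.

End SumsOfSquares.

(** * Quadratic modules and their extension by the ideal of the sphere *)

Section QuadraticModules.
Variables (R : realType) (n m : nat) (g : m.-tuple {mpoly R[n]}).
Implicit Types p q s : {mpoly R[n]}.

Lemma QM_sos s : sos s -> QM g s.
Proof.
move=> ss; exists s, (fun=> 0); split=> // [j|]; first exact: sos0.
by rewrite big1 ?addr0 // => j _; rewrite mulr0.
Qed.

Lemma QMD p q : QM g p -> QM g q -> QM g (p + q).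
Proof.
move=> [p0 [ps [sp0 sps ->]]] [q0 [qs [sq0 sqs ->]]].
exists (p0 + q0), (fun j => ps j + qs j); split=> [|j|]; [exact: sosD|exact: sosD|].
under [in RHS]eq_bigr do rewrite mulrDr.
by rewrite big_split /= addrACA.
Qed.

Lemma QM_sosM s p : sos s -> QM g p -> QM g (s * p).
Proof.
move=> ss [p0 [ps [sp0 sps ->]]]; exists (s * p0), (fun j => s * ps j).
split=> [|j|]; [exact: sosM|exact: sosM|].
by rewrite mulrDr mulr_sumr; congr (_ + _); apply: eq_bigr => j _; rewrite mulrCA.
Qed.

Lemma QM_gen j s : sos s -> QM g (tnth g j * s).
Proof.
move=> ss; exists 0, (fun i => if i == j then s else 0); split=> [|i|].
- exact: sos0.
- by case: ifP => _ //; apply: sos0.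
rewrite add0r (bigD1 j) //= eqxx big1 ?addr0 // => i /negPf ->.
by rewrite mulr0.
Qed.

Lemma QM_sum (I : Type) (r : seq I) (P : pred I) (F : I -> {mpoly R[n]}) :
  (forall i, P i -> QM g (F i)) -> QM g (\sum_(i <- r | P i) F i).
Proof.
by move=> sF; elim/big_ind: _ => //; [apply/QM_sos/sos0|apply: QMD].
Qed.

Lemma QM_ge0 p (x : 'rV[R]_n) : QM g p -> basic_semialg g x -> 0 <= p.@[x 0].
Proof.
move=> [p0 [ps [sp0 sps ->]]] gx; rewrite mevalD; apply: addr_ge0; first exact: sos_ge0.
rewrite meval_sum; apply: sumr_ge0 => j _; rewrite mevalM.
by apply: mulr_ge0; [apply: gx|apply: sos_ge0].
Qed.

Definition sphere_eq : {mpoly R[n]} := sqnorm R n - 1.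

Definition sphere_QM : set {mpoly R[n]} :=
  [set p | exists q r, QM g q /\ p = q + r * sphere_eq].

Lemma sphere_QM_QM p : QM g p -> sphere_QM p.
Proof. by move=> gp; exists p, 0; rewrite mul0r addr0. Qed.

Lemma sphere_QM_eq r : sphere_QM (r * sphere_eq).
Proof. by exists 0, r; rewrite add0r; split=> //; apply/QM_sos/sos0. Qed.

Lemma sphere_QMD p q : sphere_QM p -> sphere_QM q -> sphere_QM (p + q).
Proof.
move=> [p1 [p2 [gp1 ->]]] [q1 [q2 [gq1 ->]]].
by exists (p1 + q1), (p2 + q2); split; [exact: QMD|ring].
Qed.

Lemma sphere_QM_sosM s p : sos s -> sphere_QM p -> sphere_QM (s * p).
Proof.
move=> ss [p1 [p2 [gp1 ->]]]; exists (s * p1), (s * p2).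
by split; [exact: QM_sosM|ring].
Qed.

Definition sphere_semialg : set 'rV[R]_n :=
  [set x : 'rV[R]_n | sphere_eq.@[x 0] = 0] `&` basic_semialg g.

Lemma sphere_QM_ge0 p x : sphere_QM p -> sphere_semialg x -> 0 <= p.@[x 0].
Proof.
move=> [q [r [gq ->]]] [/= hx gx]; rewrite mevalD mevalM hx mulr0 addr0.
exact: QM_ge0.
Qed.

End QuadraticModules.

(** * Strictly positive polynomials on the sphere *)

Section Putinar.
Variables (R : realType) (n : nat).
Implicit Types (X : set 'rV[R]_n) (f p q : {mpoly R[n]}).

Lemma closed_meval_ge0 p : closed [set x : 'rV[R]_n | 0 <= p.@[x 0]].
Proof.
apply: closed_comp (@closed_ge _ (0 : R)) => x _; exact: meval_continuous.
Qed.

Lemma closed_meval_eq0 p : closed [set x : 'rV[R]_n | p.@[x 0] = 0].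
Proof.
apply: closed_comp (@closed_eq _ (0 : R)) => x _; exact: meval_continuous.
Qed.

Lemma box_compact : compact [set x : 'rV[R]_n | forall i, `|x 0 i| <= 1].
Proof.
have := @rV_compact R n (fun=> `[-1, 1]) (fun=> @segment_compact R (-1) 1).
congr (compact _); apply/funext => x; apply/propext; split=> xb i; have := xb i.
  by rewrite /= in_itv /= ler_norml.
by rewrite /= in_itv /= ler_norml.
Qed.

Lemma sqnorm_eval (x : 'I_n -> R) : (sqnorm R n).@[x] = \sum_i x i ^+ 2.
Proof. by rewrite meval_sum; apply: eq_bigr => i _; rewrite rmorphXn /= mevalXU. Qed.

Lemma sphere_box (x : 'rV[R]_n) : (sphere_eq R n).@[x 0] = 0 ->
  forall i, `|x 0 i| <= 1.
Proof.
rewrite mevalB meval1 sqnorm_eval => /eqP; rewrite subr_eq0 => /eqP x1 i.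
rewrite -(ler_pXn2r (ltn0Sn 1)) ?nnegrE // expr1n -normrX ger0_norm ?sqr_ge0 //.
by rewrite -x1 (bigD1 i) //= lerDl sumr_ge0 // => j _; apply: sqr_ge0.
Qed.

Lemma sphere_compact : compact [set x : 'rV[R]_n | (sphere_eq R n).@[x 0] = 0].
Proof.
apply: subclosed_compact box_compact _; first exact: closed_meval_eq0.
by move=> x; apply: sphere_box.
Qed.

Lemma basic_semialg_closed m (g : m.-tuple {mpoly R[n]}) : closed (basic_semialg g).
Proof.
have -> : basic_semialg g = \bigcap_(j in setT) [set x | 0 <= (tnth g j).@[x 0]].
  by apply/seteqP; split=> x gx j; [move=> _; apply: gx|apply: (gx j I)].
by apply: closed_bigI => j _; apply: closed_meval_ge0.
Qed.

Lemma sphere_semialg_compact m (g : m.-tuple {mpoly R[n]}) : compact (sphere_semialg g).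
Proof.
apply: compact_closedI; [exact: sphere_compact|exact: basic_semialg_closed].
Qed.

(* [l g (1 - g / M) ^ 2k] is small where [g >= 0] and at least [l g] in absolute
   value where [g < 0]. *)
Lemma drop_constraint X f g : compact X ->
  (forall x, X x -> 0 <= g.@[x 0] -> 0 < f.@[x 0]) ->
  exists s, forall x, X x -> 0 < (f - s ^+ 2 * g).@[x 0].
Proof.
move=> cX f_gt0.
have [M M0 gM] := compact_upper_bound cX (@meval_continuous _ _ g).
pose Xn := X `&` [set x | 0 <= (- g).@[x 0]].
have cXn : compact Xn by apply: compact_closedI => //; apply: closed_meval_ge0.
(* [l] is fixed first, on the part [g <= 0], where the factor [(1 - g / M)^(2k)] is at least 1 for
   every [k]. *)
have [||l l0 lX] := compact_penalty cXn (@meval_continuous _ _ f) (@meval_continuous _ _ (- g)).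
- by move=> x [].
- move=> x [Xx _]; rewrite mevalN => /eqP; rewrite oppr_eq0 => /eqP gx.
  by apply: f_gt0; rewrite ?gx.
pose Xp := X `&` [set x | 0 <= g.@[x 0]].
have cXp : compact Xp by apply: compact_closedI => //; apply: closed_meval_ge0.
have [|d d0 dX] := compact_lower_bound cXp (@meval_continuous _ _ f).
  by move=> x [Xx]; apply: f_gt0.
pose k := (Num.truncn (l * M / d)).+1.
(* This exponent gives [l g (1 - g / M)^(2k) <= l M / k < d] where [g >= 0]. *)
have kd : l * M < k%:R * d by rewrite -ltr_pdivrMr //; apply: truncnS_gt.
pose w : {mpoly R[n]} := 1 - (M^-1)%:MP * g.
exists ((Num.sqrt l)%:MP * w ^+ k) => x Xx.
have wE : w.@[x 0] = 1 - g.@[x 0] / M.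
  by rewrite mevalB mevalM meval1 mevalC mulrC.
rewrite mevalB mevalM rmorphXn rmorphM rmorphXn /= mevalC wE exprMn sqr_sqrtr ?ltW //.
rewrite -exprM mulnC.
have [g0|g0] := leP 0 g.@[x 0]; last first.
  have : 0 < f.@[x 0] + l * (- g).@[x 0].
    by apply: lX; split=> //=; rewrite mevalN oppr_ge0 ltW.
  rewrite mevalN.
  set W := _ ^+ (2 * k); suff W1 : 1 <= W.
    have : l * g.@[x 0] * (W - 1) <= 0.
      by rewrite mulr_le0_ge0 ?subr_ge0 // mulr_ge0_le0 // ltW.
    by lra.
  rewrite /W exprM; apply: exprn_ege1.
  have : g.@[x 0] / M <= 0 by rewrite ler_pdivrMr ?mul0r // ltW.
  by rewrite expr2 => *; nra.
have fx := dX x (conj Xx g0).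
have gM1 : g.@[x 0] / M <= 1.
  by rewrite ler_pdivrMr // mul1r (le_trans (ler_norm _)) // gM.
have gM0 : 0 <= g.@[x 0] / M by rewrite divr_ge0 // ltW.
have := @bernoulli_decay R (1 - g.@[x 0] / M) (g.@[x 0] / M) (2 * k) _ gM0 (lexx _).
rewrite subr_ge0 => /(_ gM1).
set W := _ ^+ (2 * k) => Wg.
have W0 : 0 <= W by rewrite exprn_ge0 // subr_ge0.
set y := g.@[x 0] / M in gM1 gM0 Wg W0 *.
have gE : g.@[x 0] = y * M by rewrite divfK // gt_eqF.
rewrite gE.
suff : l * W * (y * M) <= d by lra.
have k0 : 0 < k%:R :> R by rewrite ltr0n.
rewrite -(ler_pM2l k0); apply: le_trans (ltW kd).
have -> : k%:R * (l * W * (y * M)) = (l * M) * (W * (k%:R * y)) by ring.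
rewrite ler_piMr ?mulr_ge0 ?ltW //.
move: Wg; rewrite natrM; nra.
Qed.

(** The other constraints are removed first, on the smaller compact set where also [g >= 0]; then
    [g] is removed on all of [X]. [M] receives the removed terms. *)
Lemma drop_constraints (M : set {mpoly R[n]}) (gs : seq {mpoly R[n]}) X f :
  M 0 -> (forall p q, M p -> M q -> M (p + q)) ->
  (forall s g, g \in gs -> M (s ^+ 2 * g)) -> compact X ->
  (forall x, X x -> (forall g, g \in gs -> 0 <= g.@[x 0]) -> 0 < f.@[x 0]) ->
  exists2 q, M q & forall x, X x -> 0 < (f - q).@[x 0].
Proof.
move=> M0 MD; elim: gs X f => [|g gs IH] X f Mg cX f_gt0.
  by exists 0 => // x Xx; rewrite subr0; apply: f_gt0.
have [|||q Mq fq] := IH (X `&` [set x | 0 <= g.@[x 0]]) f.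
- by move=> s h hgs; apply: Mg; rewrite inE hgs orbT.
- by apply: compact_closedI => //; apply: closed_meval_ge0.
- move=> x [Xx gx] gsx; apply: f_gt0 => // h; rewrite inE => /predU1P[->//|].
  exact: gsx.
have [|s fs] := @drop_constraint X (f - q) g cX.
  by move=> x Xx gx; apply: fq.
exists (q + s ^+ 2 * g); first by apply: MD => //; apply: Mg; apply: mem_head.
by move=> x Xx; rewrite opprD addrA; apply: fs.
Qed.

(** Sums of squares modulo the ideal of the sphere. Unlike a general quadratic module, this set is
    closed under products, as the Bernstein form requires. *)
Let T p := exists s r, sos s /\ p = s + r * sphere_eq R n.

Let T_sos s : sos s -> T s.
Proof. by exists s, 0; rewrite mul0r addr0. Qed.

Let TD p q : T p -> T q -> T (p + q).
Proof.
move=> [s [r [ss ->]]] [t [u [st ->]]]; exists (s + t), (r + u).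
by split; [apply: sosD|ring].
Qed.

Let TM p q : T p -> T q -> T (p * q).
Proof.
move=> [s [r [ss ->]]] [t [u [st ->]]].
exists (s * t), (s * u + r * t + r * u * sphere_eq R n).
by split; [apply: sosM|ring].
Qed.

(* [2 (1 + e x_i) = (1 + e x_i)^2 + \sum_(j != i) x_j^2] on the sphere, for [e^2 = 1]. *)
Let T_face i (e : {mpoly R[n]}) : e ^+ 2 = 1 -> T ((1 + e * 'X_i) + (1 + e * 'X_i)).
Proof.
move=> e1; exists ((1 + e * 'X_i) ^+ 2 + \sum_(j | j != i) 'X_j ^+ 2), (- 1).
split.
  apply: sosD; first exact: sos_sqr.
  by apply: sos_sum => j _; apply: sos_sqr.
have -> : sphere_eq R n = 'X_i ^+ 2 + \sum_(j | j != i) 'X_j ^+ 2 - 1.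
  by rewrite /sphere_eq /sqnorm (bigD1 i).
rewrite sqrrD expr1n mul1r exprMn e1; ring.
Qed.

Lemma sphere_positive p :
  (forall x : 'rV[R]_n, (sphere_eq R n).@[x 0] = 0 -> 0 < p.@[x 0]) ->
  exists s r, sos s /\ p = s + r * sphere_eq R n.
Proof.
move=> p_gt0; change (T p).
(* The penalty vanishes on the sphere and makes [p] positive on the cube, the domain of
   [bernstein_positive]. *)
have [||l l0 lX] := compact_penalty box_compact (@meval_continuous _ _ p)
    (@meval_continuous _ _ (sphere_eq R n ^+ 2)).
- by move=> x _; rewrite rmorphXn sqr_ge0.
- by move=> x _ /eqP; rewrite rmorphXn sqrf_eq0 => /eqP; apply: p_gt0.
pose q := p + l%:MP * sphere_eq R n ^+ 2.
suff Tq : T q.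
  have -> : p = q + (- l%:MP * sphere_eq R n) * sphere_eq R n by rewrite /q; ring.
  by apply: TD => //; exists 0, (- l%:MP * sphere_eq R n); split; [apply: sos0|rewrite add0r].
have [|D [c [c0 ->]]] := @bernstein_positive R n q.
  by move=> x xb; rewrite mevalD mevalM mevalC; apply: lX.
have half_face (e : {mpoly R[n]}) i : e ^+ 2 = 1 -> T ((2^-1)%:MP * (1 + e * 'X_i)).
  move=> e1; have := TM (T_sos (@sosC R n (2^-1 ^+ 2) (sqr_ge0 _))) (T_face i e1).
  congr T; rewrite mulrDr -mulrDl -mpolyCD; congr (_%:MP * _).
  by rewrite expr2; lra.
have TX r k : T r -> T (r ^+ k).
  move=> Tr; elim: k => [|k IH]; first by rewrite expr0; apply/T_sos/sos1.
  by rewrite exprS; apply: TM.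
elim/big_ind: _ => [|? ?|k _]; [exact/T_sos/sos0|exact: TD|].
apply: TM; first exact/T_sos/sosC.
rewrite /bernstein_basis; elim/big_ind: _ => [|? ?|i _]; [exact/T_sos/sos1|exact: TM|].
apply: TM; first exact/T_sos/sos_nat.
apply: TM; apply: TX.
  by have := half_face 1 i; rewrite expr1n mul1r; apply.
by have := half_face (- 1) i; rewrite sqrrN expr1n mulN1r; apply.
Qed.

Theorem putinar_sphere m (g : m.-tuple {mpoly R[n]}) p :
  (forall x : 'rV[R]_n, sphere_semialg g x -> 0 < p.@[x 0]) -> sphere_QM g p.
Proof.
move=> p_gt0.
have [||||q gq pq] := @drop_constraints (QM g) g _ p _ _ _ sphere_compact.
- exact/QM_sos/sos0.
- exact: QMD.
- by move=> s h /tnthP[j ->]; rewrite mulrC; apply/QM_gen/sos_sqr.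
- move=> x hx gx; apply: p_gt0; split=> // j; apply: gx; exact: mem_tnth.
have [s [r [ss E]]] := sphere_positive pq.
exists (q + s), r; split; first by apply: QMD => //; apply: QM_sos.
by rewrite -addrA -E addrC subrK.
Qed.

End Putinar.

(** * Finite sets of points *)

Section FiniteSetsOfPoints.
Variables (R : realType) (n : nat).
Implicit Types (p q r A B D : {mpoly R[n]}) (z w : 'rV[R]_n) (zs : seq 'rV[R]_n).

Definition sqdist z : {mpoly R[n]} := \sum_i shift z i ^+ 2.

Lemma sqdist_eval z (x : 'rV[R]_n) : (sqdist z).@[x 0] = \sum_i (x 0 i - z 0 i) ^+ 2.
Proof. by rewrite meval_sum; apply: eq_bigr => i _; rewrite rmorphXn /= meval_shift. Qed.

Lemma sqdist_eq0 z (x : 'rV[R]_n) : (sqdist z).@[x 0] = 0 -> x = z.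
Proof.
rewrite sqdist_eval => /eqP; rewrite psumr_eq0 => [/allP xz|i _]; last exact: sqr_ge0.
apply/rowP => i; have := xz i (mem_index_enum i).
by rewrite sqrf_eq0 subr_eq0 => /eqP.
Qed.

Lemma sqdist_sos z : sos (sqdist z).
Proof. by apply: sos_sum => i _; apply: sos_sqr. Qed.

Lemma vanish_sqdist z : vanish z 2 (sqdist z).
Proof.
by apply: vanish_sum => i _; rewrite expr2; apply: (@vanishM _ _ _ 1 1); apply: vanish_shift.
Qed.

(** A second order expansion whose coefficients [b i j] vanish at [z], hence are small nearby; then
    [2 |x y| <= x^2 + y^2]. *)
Lemma vanish3_near z p (e : R) : vanish z 3 p -> 0 < e ->
  nbhs z [set u : 'rV[R]_n | `|p.@[u 0]| <= e * (sqdist z).@[u 0]].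
Proof.
case=> a [az ->] e0.
have /choice[b bP] i : exists b : 'I_n -> {mpoly R[n]},
    (forall j, vanish z 1 (b j)) /\ a i = \sum_j b j * shift z j.
  by have [b ?] := az i; exists b.
(* The double sum costs a factor [n]; dividing by [n + 1] also covers [n = 0]. *)
have e1 : 0 < e / n.+1%:R by rewrite divr_gt0.
have : nbhs z [set u : 'rV[R]_n | forall i j, `|(b i j).@[u 0]| <= e / n.+1%:R].
  apply: (@filter_forall _ _ (fun i => [set u : 'rV[R]_n | forall j, _]) (nbhs z)) => i.
  apply: (@filter_forall _ _ (fun j => [set u : 'rV[R]_n | _ <= _]) (nbhs z)) => j.
  have bz : (b i j).@[z 0] = 0 by apply/vanish_root; apply: (bP i).1.
  have := @meval_continuous _ _ (b i j) z; rewrite /continuous_at bz.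
  by move=> /cvgr0Pnorm_le/(_ _ e1); apply.
apply: filterS => u /= bu; rewrite meval_sum.
have -> : \sum_i (a i * shift z i).@[u 0] =
    \sum_i \sum_j (b i j).@[u 0] * ((u 0 j - z 0 j) * (u 0 i - z 0 i)).
  apply: eq_bigr => i _; rewrite mevalM (bP i).2 meval_sum mulr_suml.
  by apply: eq_bigr => j _; rewrite mevalM !meval_shift mulrA.
have sq (x y : R) : `|x * y| <= 2^-1 * x ^+ 2 + 2^-1 * y ^+ 2.
  have := sqr_ge0 (x - y); have := sqr_ge0 (x + y); rewrite !expr2 ler_norml; lra.
apply: (@le_trans _ _ (\sum_i \sum_j (e / n.+1%:R) *
    (2^-1 * (u 0 j - z 0 j) ^+ 2 + 2^-1 * (u 0 i - z 0 i) ^+ 2))).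
  apply: le_trans (ler_norm_sum _ _ _) _; apply: ler_sum => i _.
  apply: le_trans (ler_norm_sum _ _ _) _; apply: ler_sum => j _.
  by rewrite normrM ler_pM.
under eq_bigr do rewrite -mulr_sumr big_split /= -mulr_sumr -sqdist_eval sumr_const card_ord.
rewrite -mulr_sumr big_split /= sumr_const card_ord -mulrnAr sumrMnl -mulr_sumr -sqdist_eval.
set s := (sqdist z).@[_]; have s0 : 0 <= s by apply/sos_ge0/sqdist_sos.
have es := mulr_ge0 (ltW e0) s0.
rewrite mulrAC ler_pdivrMr // -[s *+ n]mulr_natl -[_ * s *+ n]mulr_natl.
have -> : n.+1%:R = n%:R + 1 :> R by rewrite natr1.
by lra.
Qed.

(** One freely chosen coordinate for each point of the list: these products generate the product of
    the maximal ideals. *)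
Inductive coord_prod : seq 'rV[R]_n -> {mpoly R[n]} -> Prop :=
| coord_prod_nil : coord_prod [::] 1
| coord_prod_cons z zs i A : coord_prod zs A -> coord_prod (z :: zs) (shift z i * A).

(* The product ideal of the [vanish z 3], [z] in [zs]. *)
Inductive cubic zs : {mpoly R[n]} -> Prop :=
| cubic0 : cubic zs 0
| cubic_add r A B D p : coord_prod zs A -> coord_prod zs B -> coord_prod zs D ->
    cubic zs p -> cubic zs (r * D * (A * B) + p).

Lemma cubicD zs p q : cubic zs p -> cubic zs q -> cubic zs (p + q).
Proof.
move=> cp cq; elim: cp => [|r A B D p' hA hB hD _ IH]; first by rewrite add0r.
by rewrite -addrA; apply: cubic_add.
Qed.

Lemma cubic_sum zs (I : Type) (s : seq I) (P : pred I) (F : I -> {mpoly R[n]}) :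
  (forall i, P i -> cubic zs (F i)) -> cubic zs (\sum_(i <- s | P i) F i).
Proof. by move=> cF; elim/big_ind: _ => //; [apply: cubic0|apply: cubicD]. Qed.

(** A term of order 3 at [z] has three coordinate factors, one for each of [D], [A] and [B]. *)
Lemma cubic_cons zs z p q : cubic zs p -> vanish z 3 q -> cubic (z :: zs) (p * q).
Proof.
move=> cp qz; elim: cp => [|r A B D p' hA hB hD _ IH]; first by rewrite mul0r; apply: cubic0.
rewrite mulrDl; apply: cubicD => // {IH p'}.
case: qz => a [az ->]; rewrite mulr_sumr; apply: cubic_sum => i _.
case: (az i) => b [bz ->]; rewrite mulr_suml mulr_sumr; apply: cubic_sum => j _.
case: (bz j) => c [cz ->]; rewrite !mulr_suml mulr_sumr; apply: cubic_sum => k _.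
have -> : r * D * (A * B) * (c k * shift z k * shift z j * shift z i) =
  (r * c k) * (shift z k * D) * ((shift z j * A) * (shift z i * B)) + 0 by ring.
by apply: cubic_add; [exact: coord_prod_cons..|exact: cubic0].
Qed.

Lemma coord_prod_vanish zs z A : z \in zs -> coord_prod zs A -> vanish z 1 A.
Proof.
move=> + hA; elim: hA => // w {}zs i {}A hA IH; rewrite inE => /predU1P[->|/IH zA].
  by apply: vanishMr; apply: vanish_shift.
exact: vanishMl.
Qed.

Lemma cubic_vanish zs z p : z \in zs -> cubic zs p -> vanish z 3 p.
Proof.
move=> zz; elim=> [|r A B D p' hA hB hD _ IH]; first exact: vanish0.
apply: vanishD => //; apply: (@vanishM _ _ _ 1 2).
  by apply: vanishMl; apply: coord_prod_vanish hD.
by apply: (@vanishM _ _ _ 1 1); apply: coord_prod_vanish; eassumption.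
Qed.

(** An affine [l] with [l(w) = 0] and [l(z) = 1] gives [e = 1 - (1 - l^3)^3]: [l^3] divides [e], and
    [(1 - l)^3] divides [1 - e]. *)
Lemma separate2 z w : z != w -> exists e, vanish w 3 e /\ vanish z 3 (1 - e).
Proof.
move=> zw; have [i zwi] : exists i, z 0 i != w 0 i.
  apply/existsP; apply: contra_neqT zw; rewrite negb_exists => /forallP zw.
  by apply/rowP => i; apply/eqP; have := zw i; rewrite negbK.
have zwi0 : z 0 i - w 0 i != 0 by rewrite subr_eq0.
pose l := ((z 0 i - w 0 i)^-1)%:MP * shift w i.
have lw : vanish w 1 l by apply: vanishMl; apply: vanish_shift.
have lz : vanish z 1 (1 - l).
  by apply/vanish_root; rewrite mevalB meval1 mevalM mevalC meval_shift mulVf ?subrr.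
have cube v q : vanish v 1 q -> vanish v 3 (q ^+ 3).
  move=> vq; rewrite !exprS expr0 mulr1.
  by apply: (@vanishM _ _ _ 1 2) => //; apply: (@vanishM _ _ _ 1 1).
exists (1 - (1 - l ^+ 3) ^+ 3); split.
  have -> : 1 - (1 - l ^+ 3) ^+ 3 = (3%:R - 3%:R * l ^+ 3 + l ^+ 6) * l ^+ 3 by ring.
  by apply: vanishMl; apply: cube.
rewrite subKr; apply: cube.
have -> : 1 - l ^+ 3 = (1 + l + l ^+ 2) * (1 - l) by ring.
exact: vanishMl.
Qed.

Lemma separate zs z : z \notin zs -> exists2 e, cubic zs e & vanish z 3 (1 - e).
Proof.
elim: zs => [_|w zs IH].
  exists 1; last by rewrite subrr; apply: vanish0.
  have -> : 1 = 1 * 1 * (1 * 1) + 0 :> {mpoly R[n]} by ring.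
  by apply: cubic_add; [exact: coord_prod_nil..|exact: cubic0].
rewrite inE negb_or => /andP[/separate2[e' [we' ze']] /IH[e ce ze]].
exists (e * e'); first exact: cubic_cons.
have -> : 1 - e * e' = (1 - e) + e * (1 - e') by ring.
by apply: vanishD => //; apply: vanishMl.
Qed.

(* Chinese remainder theorem: pairwise comaximal ideals. *)
Lemma vanish_cubic zs p : uniq zs -> (forall z, z \in zs -> vanish z 3 p) -> cubic zs p.
Proof.
elim: zs => [_ _|z zs IH /andP[zzs uzs] pz].
  have -> : p = p * 1 * (1 * 1) + 0 :> {mpoly R[n]} by ring.
  by apply: cubic_add; [exact: coord_prod_nil..|exact: cubic0].
have [e ce ze] := separate zzs.
have -> : p = e * p + p * (1 - e) by ring.
apply: cubicD; apply: cubic_cons => //; first by apply: pz; apply: mem_head.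
by apply: IH => // w wzs; apply: pz; rewrite inE wzs orbT.
Qed.

Definition sqdist_prod zs : {mpoly R[n]} := \prod_(z <- zs) sqdist z.

Lemma sqdist_prod_sos zs : sos (sqdist_prod zs).
Proof. by apply: sos_prod => z _; apply: sqdist_sos. Qed.

Lemma sqdist_prod_eq0 zs (x : 'rV[R]_n) : (sqdist_prod zs).@[x 0] = 0 -> x \in zs.
Proof.
elim: zs => [|z zs IH]; rewrite /sqdist_prod ?big_nil ?meval1.
  by move=> /eqP; rewrite oner_eq0.
rewrite big_cons mevalM => /eqP; rewrite mulf_eq0 inE => /orP[] /eqP => [/sqdist_eq0 ->|].
  by rewrite eqxx.
by move=> /IH ->; rewrite orbT.
Qed.

(** A squared coordinate differs from [sqdist] by a sum of squares. Thus a multiple of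
    [sqdist_prod zs] can dominate the products [A * B]. *)
Lemma coord_prod_le zs A : coord_prod zs A -> sos (sqdist_prod zs - A ^+ 2).
Proof.
elim=> [|z {}zs i {}A hA IH]; first by rewrite /sqdist_prod big_nil expr1n subrr; apply: sos0.
rewrite /sqdist_prod big_cons -/(sqdist_prod zs) /sqdist (bigD1 i) //=.
set S := \sum_(j | _) _.
have -> : (shift z i ^+ 2 + S) * sqdist_prod zs - (shift z i * A) ^+ 2 =
  shift z i ^+ 2 * (sqdist_prod zs - A ^+ 2) + S * sqdist_prod zs by ring.
apply: sosD; apply: sosM; rewrite ?sqdist_prod_sos //; first exact: sos_sqr.
  by apply: sos_sum => j _; apply: sos_sqr.
exact: sqdist_prod_sos.
Qed.

(** The constant is the product of the squared distances from [z] to the other points, positive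
    since the list has no repetition. *)
Lemma sqdist_prod_near zs z : uniq zs -> z \in zs ->
  exists2 a : R, 0 < a & vanish z 3 (sqdist_prod zs - a%:MP * sqdist z).
Proof.
move=> uzs zzs; rewrite /sqdist_prod (perm_big _ (perm_to_rem zzs)) big_cons /=.
set q := \prod_(w <- _) _; exists q.@[z 0].
  rewrite lt_def; apply/andP; split; last first.
    by apply/sos_ge0/sos_prod => w _; apply: sqdist_sos.
  apply/eqP => /sqdist_prod_eq0; rewrite mem_rem_uniq // !inE eqxx //.
rewrite mulrC -mulrBl; apply: (@vanishM _ _ _ 1 2); last exact: vanish_sqdist.
exact: vanish1C.
Qed.

End FiniteSetsOfPoints.

(** * From local certificates to a global one *)

(** Compactness through near coverings, along the filter of lists ordered by inclusion: near [x],
    any list containing [f x] is large enough. *)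
Lemma compact_discrete_finite (T : topologicalType) (I : eqType) (f : T -> I) (X : set T)
    (P : set T) : compact X ->
  (forall x, X x -> nbhs x [set y | X y -> P y -> f y = f x]) ->
  exists s : seq I, forall x, X x -> P x -> f x \in s.
Proof.
move=> /compact_near_coveringP cX isoP.
pose F := filter_from [set: seq I] (fun s => [set t : seq I | {subset s <= t}]).
have FF : Filter F.
  apply: filter_from_filter; first by exists [::].
  move=> s t _ _; exists (s ++ t) => // r sr.
  by split=> x xs; apply: sr; rewrite mem_cat xs ?orbT.
have [|s _ sP] := cX _ F (fun s x => X x -> P x -> f x \in s) FF.
  move=> x Xx; exists ([set y | X y -> P y -> f y = f x],
    [set t : seq I | {subset [:: f x] <= t}]).
    by split; [exact: isoP|exists [:: f x]].
  by move=> [y t] /= [yP ft] Xy Py; rewrite yP // ft // mem_head.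
by exists s => x Xx; apply: (sP s) => // y.
Qed.

Section LocalGlobal.
Variables (R : realType) (n : nat) (X : set 'rV[R]_n) (M : set {mpoly R[n]}).
(** [M] stands for [sphere_QM]; the deep hypothesis is the Positivstellensatz [M_gt0], supplied by
    [putinar_sphere]. *)
Hypotheses (cX : compact X) (MD : forall p q, M p -> M q -> M (p + q)).
Hypothesis M_sosM : forall s p, sos s -> M p -> M (s * p).
Hypothesis M_ge0 : forall p x, M p -> X x -> 0 <= p.@[x 0].
Hypothesis M_gt0 : forall p, (forall x, X x -> 0 < p.@[x 0]) -> M p.
Implicit Types (p q F : {mpoly R[n]}) (z : 'rV[R]_n) (zs : seq 'rV[R]_n).

Let M_sos s : sos s -> M s.
Proof.
move=> ss; rewrite -[s]mulr1; apply: M_sosM => //; apply: M_gt0 => x _.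
by rewrite meval1.
Qed.

Let M0 : M 0. Proof. exact/M_sos/sos0. Qed.

(** The weights [(1 - e)^2] and [e^2] are squares, so the combination stays in [M]; [e] is 1 at [z]
    and 0 on [zs], both to order 3. *)
Lemma glue zs F : uniq zs ->
  (forall z, z \in zs -> exists2 m, M m & vanish z 3 (F - m)) ->
  exists2 m, M m & forall z, z \in zs -> vanish z 3 (F - m).
Proof.
elim: zs => [|z zs IH] /=; first by exists 0.
move=> /andP[zzs uzs] mz; have [e ce ez] := separate zzs.
have [w wzs|m' Mm' m'P] := IH uzs; first by apply: mz; rewrite inE wzs orbT.
have [m Mm mP] := mz z (mem_head _ _).
exists ((1 - e) ^+ 2 * m' + e ^+ 2 * m).
  by apply: MD; apply: M_sosM => //; apply: sos_sqr.
move=> w; rewrite inE => /predU1P[->|wzs].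
  have -> : F - ((1 - e) ^+ 2 * m' + e ^+ 2 * m) =
    (F - m) + ((1 + e) * m - (1 - e) * m') * (1 - e) by ring.
  by apply: vanishD => //; apply: vanishMl.
have -> : F - ((1 - e) ^+ 2 * m' + e ^+ 2 * m) =
  (F - m') + ((2%:R - e) * m' - e * m) * e by ring.
apply: vanishD; first exact: m'P.
by apply: vanishMl; apply: cubic_vanish ce.
Qed.

(* [r A B + (d/2) (A^2 + B^2) = (d+r)/4 (A+B)^2 + (d-r)/4 (A-B)^2], and [r] is small
   after multiplication by a high power of [w]. *)
Lemma absorb_cubic zs p w (d : R) :
  (forall x, X x -> 0 <= w.@[x 0] <= 1) ->
  (forall x, X x -> w.@[x 0] = 1 -> x \in zs) ->
  cubic zs p -> 0 < d ->
  exists N0, forall N, (N0 <= N)%N -> M (d%:MP * sqdist_prod zs + w ^+ N * p).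
Proof.
move=> w01 w1 cp; elim: cp d => [|r A B D p' hA hB hD _ IH] d d0.
  exists 0%N => N _; rewrite mulr0 addr0.
  by apply/M_sos/sosM; [apply/sosC/ltW|apply: sqdist_prod_sos].
have d20 : 0 < d / 2 by rewrite divr_gt0.
have [N1 HN1] := IH _ d20.
(* Where [w = 1] the point lies in [zs], and [D] vanishes there. *)
have small s : exists N0, forall N, (N0 <= N)%N -> forall x, X x ->
    (s * D).@[x 0] * w.@[x 0] ^+ N < d / 2.
  apply: compact_power_small => //; try exact: meval_continuous.
  move=> x Xx /(w1 x Xx) xzs; rewrite mevalM.
  have /vanish_root -> : vanish x 1 D by apply: coord_prod_vanish hD.
  by rewrite mulr0.
have [N2 HN2] := small r; have [N3 HN3] := small (- r).
exists (maxn N1 (maxn N2 N3)) => N; rewrite !geq_max => /andP[N1N /andP[N2N N3N]].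
pose t := w ^+ N * (r * D).
pose c : {mpoly R[n]} := (d / 8)%:MP; pose h : {mpoly R[n]} := (4^-1)%:MP.
have cd k : (d / 8 * k%:R)%:MP = c * k%:R by rewrite mpolyCM mpolyC_nat.
have h4 : h * 4%:R = 1.
  by rewrite -mpolyC_nat -mpolyCM mulVf ?mpolyC1 // pnatr_eq0.
(* Half of [d] is left to the induction, the other half pays for [A * B]; [c + h t] and [c - h t]
   are positive on [X] because [|t| < d / 2]. *)
have -> : d%:MP * sqdist_prod zs + w ^+ N * (r * D * (A * B) + p') =
  ((d / 2)%:MP * sqdist_prod zs + w ^+ N * p') +
  (c * 2%:R * ((sqdist_prod zs - A ^+ 2) + (sqdist_prod zs - B ^+ 2)) +
  ((A + B) ^+ 2 * (c + h * t) + (A - B) ^+ 2 * (c - h * t))).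
  have -> : d = d / 8 * 8%:R by field.
  have -> : d / 8 * 8%:R / 2 = d / 8 * 4%:R by field.
  rewrite !cd -[r * D * (A * B)]mul1r -[X in X * (r * D * (A * B))]h4 /t; ring.
apply: MD; first exact: HN1.
apply: MD.
  apply: M_sosM; last by apply/M_sos/sosD; apply: coord_prod_le.
  by rewrite -cd; apply: sosC; rewrite mulr_ge0 // divr_ge0 // ltW.
have tE x : t.@[x] = w.@[x] ^+ N * (r.@[x] * D.@[x]) by rewrite !mevalM rmorphXn.
apply: MD; (apply: M_sosM; first exact: sos_sqr); apply: M_gt0 => x Xx.
  rewrite mevalD mevalM !mevalC tE.
  by have := HN3 N N3N x Xx; rewrite mevalM mevalN; lra.
rewrite mevalB mevalM !mevalC tE.
by have := HN2 N N2N x Xx; rewrite mevalM; lra.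
Qed.

Lemma positive_weight_all (T : eqType) (s : seq T) (P : T -> R -> Prop) :
  (forall x, x \in s -> exists2 c0, 0 < c0 & forall c, 0 < c -> c <= c0 -> P x c) ->
  exists2 c, 0 < c & forall x, x \in s -> P x c.
Proof.
move=> Ps; suff [c0 c00 cP] : exists2 c0, 0 < c0 &
    forall x, x \in s -> forall c, 0 < c -> c <= c0 -> P x c.
  by exists c0 => // x xs; apply: cP.
elim: s Ps => [|y s IH] Ps; first by exists 1.
have [c1 c10 c1P] := Ps y (mem_head _ _).
have [x xs|c2 c20 c2P] := IH; first by apply: Ps; rewrite inE xs orbT.
exists (Num.min c1 c2) => [|x]; first by rewrite lt_min c10.
rewrite inE => xs c c0; rewrite le_min => /andP[cc1 cc2].
by case/predU1P: xs => [->|xs]; [apply: c1P|apply: c2P].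
Qed.

(** The algebraic form of quadratic growth at a zero of [F]. *)
Definition local_certificate F z :=
  exists2 c : R, 0 < c & exists2 m, M m & vanish z 3 (F - m - c%:MP * sqdist z).

(** Near [z] the cubic error is at most [(c / 2) |u - z|^2], whereas at a zero [u] it equals
    [- m(u) - c |u - z|^2] with [m(u) >= 0]. *)
Lemma certificate_isolated F z : local_certificate F z ->
  nbhs z [set u | X u -> F.@[u 0] = 0 -> u = z].
Proof.
move=> [c c0 [m Mm /vanish3_near nz]].
have := nz _ (divr_gt0 c0 (ltr0n R 2)); apply: filterS => u /= + Xu Fu.
rewrite !mevalB mevalM mevalC Fu => H; apply: sqdist_eq0.
have m0 := M_ge0 Mm Xu; have : 0 <= (sqdist z).@[u 0] by apply/sos_ge0/sqdist_sos.
rewrite le_eqVlt => /predU1P[<- //|q0]; move: H; rewrite ler_norml => /andP[H _].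
by have := mulr_gt0 c0 q0; lra.
Qed.

Lemma vanish_pow_sub1 z q k (e : R) : vanish z 2 q ->
  vanish z 2 (1 - (1 - e%:MP * q) ^+ k).
Proof.
move=> vq; rewrite -opprB subrX1; apply: vanishN; apply: vanishMr.
by rewrite addrAC subrr add0r; apply: vanishN; apply: vanishMl.
Qed.

(* [F - m - c q] vanishes to order 3 on the zeros. Damping [m2 = m + (c/2) q] by [w ^ 2k],
   with [w = 1] exactly on the zeros, makes [Phi = F - w^2k m2] positive on [X] off the
   zeros. Then [Phi = (c/2) q + P] with [P] of order 3, and
   [Phi = (d q + w^N P) + q (c/2 - d + om P)] where [1 - w^N = om q]: the first term is
   handled by [absorb_cubic], and the second factor of the second term is positive on [X]. *)
Theorem local_global F :
  (forall x, X x -> 0 <= F.@[x 0]) ->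
  (forall x, X x -> F.@[x 0] = 0 -> local_certificate F x) -> M F.
Proof.
move=> F_ge0 F_loc.
have [zs [uzs zsX zsP]] : exists zs : seq 'rV[R]_n, [/\ uniq zs,
    (forall z, z \in zs -> X z /\ F.@[z 0] = 0) &
    forall x, X x -> F.@[x 0] = 0 -> x \in zs].
  have [|zs zsP] := @compact_discrete_finite _ _ id X [set x | F.@[x 0] = 0] cX.
    move=> x Xx; have [Fx|/eqP Fx] := eqVneq F.@[x 0] 0.
      have := certificate_isolated (F_loc x Xx Fx); apply: filterS => u uP Xu Fu.
      exact: uP.
    have : nbhs x (~` [set y : 'rV[R]_n | F.@[y 0] = 0]).
      by apply: open_nbhs_nbhs; split=> //; rewrite openC; apply: closed_meval_eq0.
    by apply: filterS => u /= Fu Xu /Fu.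
  exists (undup [seq z <- zs | `[< X z >] && (F.@[z 0] == 0)]); split.
  - exact: undup_uniq.
  - by move=> z; rewrite mem_undup mem_filter => /andP[/andP[/asboolP Xz /eqP]].
  - move=> x Xx Fx; rewrite mem_undup mem_filter zsP // Fx eqxx !andbT.
    exact/asboolP.
pose q := sqdist_prod zs.
have qz z : z \in zs -> vanish z 2 q.
  move=> zz; have [a _ aP] := sqdist_prod_near uzs zz.
  rewrite -[q](subrK (a%:MP * sqdist z)); apply: vanishD; first exact/vanishW/aP.
  by apply: vanishMl; apply: vanish_sqdist.
have q_sos : sos q by apply: sqdist_prod_sos.
have q_ge0 (x : 'rV[R]_n) : 0 <= q.@[x 0] by apply: sos_ge0.
have [c c0 cP] : exists2 c : R, 0 < c & forall z, z \in zs ->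
    exists2 m, M m & vanish z 3 (F - c%:MP * q - m).
  apply: positive_weight_all => z zz; have [Xz Fz] := zsX z zz.
  have [a a0 aP] := sqdist_prod_near uzs zz.
  have [c1 c10 [m Mm mP]] := F_loc z Xz Fz.
  (* As [q] is [a * sqdist z] up to order 3, any [c <= c1 / a] leaves a nonnegative multiple of
     [sqdist z], which is moved into the module part. *)
  exists (c1 / a) => [|c c0 cc1]; first exact: divr_gt0.
  exists (m + (c1 - c * a)%:MP * sqdist z).
    apply: MD => //; apply/M_sos/sosM; last exact: sqdist_sos.
    by apply: sosC; rewrite subr_ge0 -ler_pdivlMr.
  have -> : F - c%:MP * q - (m + (c1 - c * a)%:MP * sqdist z) =
    F - m - c1%:MP * sqdist z - c%:MP * (q - a%:MP * sqdist z).
    by rewrite mpolyCB mpolyCM; ring.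
  by apply: vanishB => //; apply: vanishMl.
have [m Mm mP] := glue uzs cP.
pose m2 := m + (c / 2)%:MP * q.
have Mm2 : M m2.
  by apply: MD => //; apply/M_sos/sosM => //; apply/sosC/ltW/divr_gt0.
have half : (c / 2)%:MP + (c / 2)%:MP = c%:MP :> {mpoly R[n]}.
  by rewrite -mpolyCD -splitr.
have m2E : F - m2 - (c / 2)%:MP * q = F - c%:MP * q - m by rewrite -half /m2; ring.
have m2z z : z \in zs -> m2.@[z 0] = 0.
  move=> zz; have := mP z zz; rewrite -m2E => /vanishW/vanishW/vanish_root.
  rewrite !mevalB mevalM (zsX z zz).2.
  have /vanishW/vanish_root -> := qz z zz.
  by rewrite mulr0 subr0 sub0r => /eqP; rewrite oppr_eq0 => /eqP.
(* [F - m2] is [(c / 2) q] up to order 3, so the smaller constant [c / 4] makes [V] a neighbourhood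
   of every zero. *)
pose V := [set u : 'rV[R]_n | 0 <= (F - m2 - (c / 4)%:MP * q).@[u 0]]^°.
have Vz z : z \in zs -> V z.
  move=> zz; have [a a0 aP] := sqdist_prod_near uzs zz.
  have a20 : 0 < a / 2 by rewrite divr_gt0.
  have e0 : 0 < c * a / 8 by rewrite divr_gt0 // mulr_gt0.
  have n1 := vanish3_near aP a20; have n2 := vanish3_near (mP z zz) e0.
  apply: filterS (filterI n1 n2) => u /= [].
  rewrite -m2E; move: (F - m2) => G.
  rewrite !mevalB !mevalM !mevalC !ler_norml => /andP[+ _] /andP[+ _].
  have : 0 <= (sqdist z).@[u 0] by apply/sos_ge0/sqdist_sos.
  move: (sqdist z).@[u 0] q.@[u 0] G.@[u 0] => s t y s0 H1 H2.
  have : c * (- (a / 2 * s)) <= c * (t - a * s) by rewrite ler_pM2l.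
  have := mulr_ge0 (mulr_ge0 (ltW c0) (ltW a0)) s0; lra.
pose Y := X `&` ~` V.
have cY : compact Y.
  by apply: compact_closedI => //; apply: open_closedC; apply: open_interior.
have qY x : Y x -> 0 < q.@[x 0].
  move=> [Xx nVx]; rewrite lt_def q_ge0 andbT; apply/eqP => /sqdist_prod_eq0 xz.
  by apply: nVx; apply: Vz.
have [|d d0 dY] := compact_lower_bound cY (@meval_continuous _ _ F).
  move=> x [Xx nVx]; rewrite lt_def F_ge0 // andbT; apply/eqP => Fx.
  by apply/nVx/Vz/zsP.
have [C C0 qC] := compact_upper_bound cX (@meval_continuous _ _ q).
have {}qC x : X x -> q.@[x 0] <= C by move=> Xx; apply: le_trans (qC x Xx); apply: ler_norm.
pose w : {mpoly R[n]} := 1 - (C^-1)%:MP * q.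
have wE (x : 'rV[R]_n) : w.@[x 0] = 1 - q.@[x 0] / C.
  by rewrite mevalB mevalM meval1 mevalC mulrC.
have w01 x : X x -> 0 <= w.@[x 0] <= 1.
  move=> Xx; rewrite wE subr_ge0 ler_pdivrMr // mul1r qC //=.
  by rewrite gerBl divr_ge0 // ltW.
have w1 (x : 'rV[R]_n) : w.@[x 0] = 1 -> q.@[x 0] = 0.
  rewrite wE => H; have /eqP : q.@[x 0] / C = 0 by lra.
  by rewrite mulf_eq0 invr_eq0 (gt_eqF C0) orbF => /eqP.
have [||k kP] := @compact_power_small R _ Y (fun x => m2.@[x 0]) (fun x => w.@[x 0]) (d / 2) cY
    (@meval_continuous _ _ m2) (@meval_continuous _ _ w) (divr_gt0 d0 (ltr0n R 2)).
- by move=> x [Xx _]; apply: w01.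
- by move=> x Yx /w1 qx; have := qY x Yx; rewrite qx ltxx.
pose m3 := (w ^+ k) ^+ 2 * m2; pose Phi := F - m3.
have Mm3 : M m3 by apply: M_sosM => //; apply: sos_sqr.
have m3E (x : 'rV[R]_n) : m3.@[x 0] = m2.@[x 0] * w.@[x 0] ^+ (k * 2).
  by rewrite mevalM -exprM rmorphXn mulrC.
(* On [V], [Phi >= F - m2 >= (c / 4) q]; off [V], [Phi > d / 2] and [q <= C]. The two bounds serve
   these two cases. *)
pose d1 := Num.min (c / 8) (d / (4 * C)).
have d10 : 0 < d1 by rewrite lt_min !divr_gt0 // mulr_gt0.
have d1c : d1 <= c / 8 by rewrite ge_min lexx.
have d1C : d1 <= d / (4 * C) by rewrite ge_min lexx orbT.
have Phi_gt x : X x -> q.@[x 0] != 0 -> d1 * q.@[x 0] < Phi.@[x 0].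
  move=> Xx qx; have {qx} q0 : 0 < q.@[x 0] by rewrite lt_def qx q_ge0.
  rewrite mevalB m3E; have [Vx|nVx] := pselect (V x).
    have H : 0 <= F.@[x 0] - m2.@[x 0] - c / 4 * q.@[x 0].
      by have := interior_subset Vx; rewrite /= !mevalB mevalM mevalC.
    have /andP[wx0 wx1] := w01 x Xx.
    have : m2.@[x 0] * w.@[x 0] ^+ (k * 2) <= m2.@[x 0].
      by rewrite ler_piMr ?M_ge0 // exprn_ile1.
    have : d1 * q.@[x 0] <= c / 8 * q.@[x 0] by rewrite ler_pM2r.
    have := mulr_gt0 c0 q0; lra.
  have Fd := dY x (conj Xx nVx).
  have kk : (k <= k * 2)%N by lia.
  have := kP _ kk x (conj Xx nVx).
  have : d1 * q.@[x 0] <= d / (4 * C) * C.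
    apply: ler_pM => //; [exact: ltW|exact: qC].
  have -> : d / (4 * C) * C = d / 4 by field; rewrite gt_eqF.
  lra.
pose P := Phi - (c / 2)%:MP * q.
have Pz z : z \in zs -> vanish z 3 P.
  move=> zz; have -> : P = (F - c%:MP * q - m) + (1 - w ^+ (k * 2)) * m2.
    by rewrite -m2E /P /Phi /m3 exprM; ring.
  apply: vanishD; first exact: mP.
  apply: (@vanishM _ _ _ 2 1); first exact/vanish_pow_sub1/qz.
  by apply/vanish_root/m2z.
have [|N0 N0P] := @absorb_cubic zs P w d1 w01 _ (vanish_cubic uzs Pz) d10.
  by move=> x Xx /w1/sqdist_prod_eq0.
pose om : {mpoly R[n]} := (C^-1)%:MP * \sum_(i < N0) w ^+ i.
have omE : 1 - w ^+ N0 = om * q.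
  by rewrite -opprB subrX1 /om /w; ring.
have -> : F = m3 + ((d1%:MP * q + w ^+ N0 * P) + q * ((c / 2 - d1)%:MP + om * P)).
  have -> : q * ((c / 2 - d1)%:MP + om * P) = (c / 2 - d1)%:MP * q + (1 - w ^+ N0) * P.
    by rewrite omE; ring.
  by rewrite mpolyCB /P /Phi; ring.
apply: MD => //; apply: MD; first exact: N0P.
apply: M_sosM => //; apply: M_gt0 => x Xx.
have [qx|qx] := eqVneq q.@[x 0] 0.
  have /vanishW/vanishW/vanish_root Px := Pz x (sqdist_prod_eq0 qx).
  by rewrite mevalD mevalM Px mulr0 addr0 mevalC; lra.
have q0 : 0 < q.@[x 0] by rewrite lt_def qx q_ge0.
(* Times [q], the factor becomes [(c / 2 - d1) q + (1 - w^N0) P], positive because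
   [P > (d1 - c / 2) q] and [0 <= 1 - w^N0 <= 1]. *)
rewrite -(pmulr_rgt0 _ q0).
have := congr1 (meval (x 0)) omE; rewrite mevalB meval1 mevalM rmorphXn /= => omx.
rewrite mevalD mevalM mevalC mulrDr [q.@[_] * (om.@[_] * _)]mulrA (mulrC q.@[_] om.@[_]) -omx.
have := Phi_gt x Xx qx.
have PhiE : Phi = P + (c / 2)%:MP * q by rewrite subrK.
rewrite PhiE mevalD mevalM mevalC.
have /andP[wx0 wx1] := w01 x Xx.
have : 0 <= w.@[x 0] ^+ N0 <= 1 by rewrite exprn_ge0 // exprn_ile1.
move: (w.@[x 0] ^+ N0) P.@[x 0] (q.@[x 0]) q0 => t y s s0 /andP[t0 t1] H.
have cs : 0 < (c / 2 - d1) * s by rewrite mulr_gt0 //; lra.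
have [y0|y0] := leP 0 y.
  by have : 0 <= (1 - t) * y by [rewrite mulr_ge0 // subr_ge0]; lra.
have : t * y <= 0 by rewrite mulr_ge0_le0 // ltW.
lra.
Qed.

End LocalGlobal.

(** * Quadratic forms *)

Section QuadraticForms.
Variables (R : realType).

(** Completing the square at the pivot [a] leaves a matrix with zero first row and column, whose
    remaining block [C] is again positive definite. *)
Lemma PD_gram (n : nat) (H : 'M[R]_n) : H^T = H ->
  (forall v : 'rV_n, v != 0 -> 0 < (v *m H *m v^T) 0 0) ->
  exists s : seq 'rV[R]_n, H = \sum_(l <- s) l^T *m l.
Proof.
elim: n H => [|n IH] H Hsym Hpos; first by exists [::]; apply/matrixP => -[].
pose b : 'rV[R]_(1 + n) := row 0 H; pose a := H 0 0.
have a0 : 0 < a.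
  have := Hpos (delta_mx 0 0); rewrite -rowE trmx_delta -colE !mxE; apply.
  by apply/eqP => /matrixP/(_ 0 0); rewrite !mxE !eqxx => /eqP; rewrite oner_eq0.
have aN0 : a != 0 by rewrite gt_eqF.
pose H1 : 'M[R]_(1 + n) := H - a^-1 *: (b^T *m b).
have H1E i j : H1 i j = H i j - a^-1 * (H 0 i * H 0 j).
  by rewrite !mxE big_ord1 !mxE.
have HE : H = H1 + a^-1 *: (b^T *m b) by rewrite subrK.
clearbody H1.
have Hji i j : H i j = H j i by rewrite -[in LHS]Hsym mxE.
have H10 j : H1 0 j = 0 by rewrite H1E mulKf // subrr.
have H1sym i j : H1 i j = H1 j i by rewrite !H1E Hji (mulrC (H 0 i)).
pose C := drsubmx H1.
have l0 : lshift n (0 : 'I_1) = 0 :> 'I_(1 + n) by apply/val_inj.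
have H1C : H1 = block_mx 0 0 0 C.
  rewrite -[LHS]submxK; congr block_mx; apply/matrixP => i j; rewrite !mxE.
  - by rewrite ord1 l0 H10.
  - by rewrite ord1 l0 H10.
  - by rewrite H1sym (ord1 j) l0 H10.
have [||s sC] := IH C.
- by apply/matrixP => i j; rewrite !mxE H1sym.
- move=> v v0; pose br : 'rV[R]_n := rsubmx b.
  (* [t] makes [w] orthogonal to [b]; there the form of [H] reduces to that of [C] at [v]. *)
  pose t : 'rV[R]_1 := - (a^-1 *: (v *m br^T)); pose w : 'rV[R]_(1 + n) := row_mx t v.
  have wb : w *m b^T = 0.
    have -> : b = row_mx a%:M br.
      rewrite -[b]hsubmxK; congr row_mx; apply/matrixP => i j.
      by rewrite !ord1 !mxE l0 mulr1n.
    rewrite tr_row_mx mul_row_col tr_scalar_mx mul_mx_scalar scalerN scalerA mulfV //.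
    by rewrite scale1r addNr.
  have w0 : w != 0.
    apply: contra_neq v0 => /(congr1 rsubmx); rewrite row_mxKr => ->.
    by apply/matrixP => i j; rewrite !mxE.
  have := Hpos w w0; rewrite HE.
  rewrite mulmxDr mulmxDl -scalemxAr mulmxA wb mul0mx scaler0 mul0mx addr0 H1C /w.
  have wE : row_mx t v *m (block_mx 0 0 0 C : 'M_(1 + n)) *m (row_mx t v)^T = v *m C *m v^T.
    by rewrite mul_row_block !mulmx0 !add0r tr_row_mx mul_row_col mul0mx add0r.
  by rewrite -wE.
exists (Num.sqrt a^-1 *: b :: [seq row_mx 0 l | l <- s]).
rewrite big_cons big_map.
rewrite HE.
rewrite addrC; congr (_ + _).
  apply/matrixP => i j; rewrite !mxE !big_ord1 !mxE mulrACA -expr2 sqr_sqrtr //.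
  by rewrite invr_ge0 ltW.
rewrite H1C sC; elim: s {sC} => [|l s IHs]; first by rewrite !big_nil block_mx0.
rewrite !big_cons -IHs.
have -> : (row_mx 0 l)^T *m row_mx 0 l = (block_mx 0 0 0 (l^T *m l) : 'M_(1 + n)).
  by rewrite tr_row_mx mul_col_row !trmx0 !mul0mx !mulmx0.
by rewrite [RHS](@add_block_mx _ 1 n 1 n) !addr0.
Qed.

Variables (n : nat).
Implicit Types (H B : 'M[R]_n) (u v z l : 'rV[R]_n).

Lemma quadratic_form_eval z H v :
  (quadratic_form z H).@[v 0] = ((v - z) *m H *m (v - z)^T) 0 0.
Proof.
rewrite /quadratic_form exchange_big meval_sum mxE; apply: eq_bigr => j _ /=.
rewrite meval_sum !mxE mulr_suml; apply: eq_bigr => i _.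
by rewrite !mevalM mevalC !meval_shift !mxE mulrAC mulrC mulrA mulrAC.
Qed.

Definition linear_form z l : {mpoly R[n]} := \sum_i (l 0 i)%:MP * shift z i.

Lemma quadratic_formD z H B : quadratic_form z (H + B) = quadratic_form z H + quadratic_form z B.
Proof.
rewrite -big_split; apply: eq_bigr => i _; rewrite -big_split; apply: eq_bigr => j _.
by rewrite mxE mpolyCD !mulrDl.
Qed.

Lemma quadratic_formZ z (c : R) H : quadratic_form z (c *: H) = c%:MP * quadratic_form z H.
Proof.
rewrite mulr_sumr; apply: eq_bigr => i _; rewrite mulr_sumr; apply: eq_bigr => j _.
by rewrite mxE mpolyCM !mulrA.
Qed.

Lemma quadratic_form_gram z l : quadratic_form z (l^T *m l) = linear_form z l ^+ 2.
Proof.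
rewrite expr2 {1}/linear_form mulr_suml; apply: eq_bigr => i _.
rewrite mulr_sumr; apply: eq_bigr => j _.
by rewrite !mxE big_ord1 !mxE mpolyCM; ring.
Qed.

Lemma quadratic_form0 z : quadratic_form z 0 = 0.
Proof. by apply: big1 => i _; apply: big1 => j _; rewrite mxE mpolyC0 !mul0r. Qed.

Lemma quadratic_form1 z : quadratic_form z 1%:M = sqdist z.
Proof.
apply: eq_bigr => i _; rewrite (bigD1 i) //= mxE eqxx mpolyC1 mul1r expr2.
by rewrite big1 ?addr0 // => j /negPf ij; rewrite mxE eq_sym ij mpolyC0 !mul0r.
Qed.

Lemma sphere_neq0 v : (sphere_eq R n).@[v 0] = 0 -> v != 0.
Proof.
rewrite mevalB meval1 sqnorm_eval => /eqP; apply: contraTneq => ->.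
rewrite big1 => [|i _]; last by rewrite mxE expr0n.
by rewrite sub0r oppr_eq0 oner_eq0.
Qed.

Lemma PD_sphere H : (forall v, (sphere_eq R n).@[v 0] = 0 -> 0 < (v *m H *m v^T) 0 0) ->
  forall v, v != 0 -> 0 < (v *m H *m v^T) 0 0.
Proof.
move=> Hpos v v0; pose r := \sum_i v 0 i ^+ 2.
have r0 : 0 < r.
  rewrite lt_def sumr_ge0 => [|i _]; last exact: sqr_ge0.
  rewrite andbT; apply: contra_neq v0 => r0; apply: sqdist_eq0.
  by rewrite sqdist_eval -[RHS]r0; apply: eq_bigr => i _; rewrite mxE subr0.
have sr0 : 0 < Num.sqrt r by rewrite sqrtr_gt0.
have := Hpos ((Num.sqrt r)^-1 *: v); rewrite mevalB meval1 sqnorm_eval.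
have -> : \sum_i ((Num.sqrt r)^-1 *: v) 0 i ^+ 2 = 1.
  under eq_bigr do rewrite mxE exprMn.
  by rewrite -mulr_sumr exprVn sqr_sqrtr ?ltW // mulVf // gt_eqF.
rewrite subrr => /(_ erefl); rewrite linearZ /= -!scalemxAl -scalemxAr !mxE mulrA.
by rewrite pmulr_rgt0 // mulr_gt0 // invr_gt0.
Qed.

(** By homogeneity the unit sphere suffices; there [B] is a penalty that vanishes only where [H] is
    positive. *)
Lemma finsler H B : (forall v, 0 <= (v *m B *m v^T) 0 0) ->
  (forall v, v != 0 -> (v *m B *m v^T) 0 0 = 0 -> 0 < (v *m H *m v^T) 0 0) ->
  exists2 k, 0 < k & forall v, v != 0 -> 0 < (v *m (H + k *: B) *m v^T) 0 0.
Proof.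
move=> B0 HB; have E A v : (quadratic_form 0 A).@[v 0] = (v *m A *m v^T) 0 0.
  by rewrite quadratic_form_eval subr0.
have [||k k0 kP] := compact_penalty (@sphere_compact R n)
    (@meval_continuous _ _ (quadratic_form 0 H)) (@meval_continuous _ _ (quadratic_form 0 B)).
- by move=> v _; rewrite E.
- by move=> v /sphere_neq0 v0; rewrite !E; apply: HB.
exists k => //; apply: PD_sphere => v hv; have := kP v hv; rewrite !E.
by rewrite mulmxDr mulmxDl -scalemxAr -scalemxAl !mxE.
Qed.

(** [c] bounds the form from below on the unit sphere, so [H - c I] is still positive definite and
    has a Gram decomposition. *)
Lemma PD_sqdist H : H^T = H -> (forall v, v != 0 -> 0 < (v *m H *m v^T) 0 0) ->
  exists2 c, 0 < c & forall z, exists2 s, sos s & quadratic_form z H = c%:MP * sqdist z + s.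
Proof.
move=> Hsym Hpos.
have [|c c0 cP] := compact_lower_bound (@sphere_compact R n)
    (@meval_continuous _ _ (quadratic_form 0 H)).
  by move=> v /sphere_neq0 v0; rewrite quadratic_form_eval subr0; apply: Hpos.
have [||s sP] := @PD_gram n (H - c%:M).
- by rewrite linearB /= Hsym tr_scalar_mx.
- apply: PD_sphere => v hv; have := cP v hv; rewrite quadratic_form_eval subr0.
  have : (v *m c%:M *m v^T) 0 0 = c.
    rewrite mul_mx_scalar -scalemxAl !mxE; move: hv; rewrite mevalB meval1 sqnorm_eval.
    move/eqP; rewrite subr_eq0 => /eqP v1.
    rewrite (eq_bigr (fun i => v 0 i ^+ 2)) ?v1 ?mulr1 // => i _.
    by rewrite mxE expr2.
  by rewrite mulmxBr mulmxBl !mxE; lra.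
exists c => // z; exists (\sum_(l <- s) linear_form z l ^+ 2).
  by apply: sos_sum => l _; apply: sos_sqr.
have -> : H = c *: 1%:M + \sum_(l <- s) l^T *m l by rewrite -sP scalemx1 addrC subrK.
rewrite quadratic_formD quadratic_formZ quadratic_form1; congr (_ + _).
rewrite (big_morph _ (quadratic_formD z) (quadratic_form0 z)).
by apply: eq_bigr => l _; apply: quadratic_form_gram.
Qed.

End QuadraticForms.

(** * Local certificate from the optimality conditions *)

Lemma free_map_coef (K : fieldType) (V : vectType K) (I : eqType) (s : seq I)
    (G : I -> V) (c : I -> K) :
  free (map G s) -> \sum_(i <- s) c i *: G i = 0 -> forall i, i \in s -> c i = 0.
Proof.
elim: s => //= j s IH; rewrite free_cons big_cons => /andP[Gj fs] sum0.
have c0 : c j = 0.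
  apply: contraNeq Gj => cj0; have -> : G j = - (c j)^-1 *: \sum_(i <- s) c i *: G i.
    move/eqP: sum0; rewrite addrC addr_eq0 => /eqP ->.
    by rewrite scaleNr scalerN opprK scalerA mulVf // scale1r.
  apply: rpredZ; rewrite big_seq; apply: rpred_sum => i si; apply: rpredZ.
  by apply: memv_span; apply: map_f.
move=> i; rewrite inE => /predU1P[-> //|]; apply: IH => //.
by rewrite c0 scale0r add0r in sum0.
Qed.

Section OptimalityConditions.
Variables (R : realType) (n p m : nat) (P : poly_problem R n p m).
Implicit Types (u : 'rV[R]_n) (mu : 'I_p -> R) (la : 'I_m -> R).

Lemma big_active (T : nmodType) u (F : {mpoly R[n]} -> T) : feasible P u ->
  \sum_(h <- active P u) F h = \sum_i F (tnth (eqs P) i) +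
    \sum_(j | (tnth (ineqs P) j).@[u 0] == 0) F (tnth (ineqs P) j).
Proof.
move=> [ue _]; rewrite big_filter big_cat !big_tuple; congr (_ + _).
by apply: eq_bigl => i; rewrite ue eqxx.
Qed.

(** [SCC] and [SOSC] each come with their own multipliers and must be made to share them.
    Complementarity removes the inactive constraints; the difference is then a relation among the
    independent active gradients. *)
Lemma multipliers_unique u mu la mu' la' : feasible P u -> LICQC P u ->
  multipliers P u mu la -> multipliers P u mu' la' -> la =1 la'.
Proof.
move=> [ue _] licq [g1 la0 laC] [g2 la'0 la'C].
pose h (x : 'I_p + 'I_m) := match x with inl i => tnth (eqs P) i | inr j => tnth (ineqs P) j end.
pose c (x : 'I_p + 'I_m) := match x with inl i => mu i - mu' i | inr j => la j - la' j end.
pose s := [seq x <- map inl (enum 'I_p) ++ map inr (enum 'I_m) | (h x).@[u 0] == 0].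
have act : [seq grad h u | h <- active P u] = [seq grad (h x) u | x <- s].
  rewrite (map_comp (fun q => grad q u) h); congr map.
  rewrite /active /s !filter_cat !filter_map map_cat -!map_comp.
  by rewrite -{1}(map_tnth_enum (eqs P)) -{1}(map_tnth_enum (ineqs P)) !filter_map -?map_comp.
have sum0 : \sum_(x <- s) c x *: grad (h x) u = 0.
  rewrite big_filter big_cat !big_map -!enumT !big_enum_cond /=.
  rewrite (eq_bigl xpredT) => [|i]; last by rewrite ue eqxx.
  have -> : \sum_(j | (tnth (ineqs P) j).@[u 0] == 0)
        (la j - la' j) *: grad (tnth (ineqs P) j) u =
      \sum_j (la j - la' j) *: grad (tnth (ineqs P) j) u.
    rewrite [RHS](bigID (fun j => (tnth (ineqs P) j).@[u 0] == 0)) /=.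
    rewrite [X in _ = _ + X]big1 ?addr0 // => j hj.
    have := laC j; have := la'C j => /eqP; rewrite mulf_eq0 (negPf hj) orbF => /eqP ->.
    by move/eqP; rewrite mulf_eq0 (negPf hj) orbF => /eqP ->; rewrite subrr scale0r.
  under eq_bigr do rewrite scalerBl; under [X in _ + X]eq_bigr do rewrite scalerBl.
  rewrite !sumrB addrACA -opprD -g1 -g2 subrr //.
move: licq; rewrite /LICQC act => /free_map_coef/(_ sum0) c0 j.
have [hj|hj] := eqVneq ((tnth (ineqs P) j).@[u 0]) 0.
  apply/eqP; rewrite -subr_eq0; apply/eqP/(c0 (inr j)).
  by rewrite mem_filter /= hj eqxx mem_cat (map_f inr) ?orbT // mem_enum.
have := laC j; have := la'C j => /eqP; rewrite mulf_eq0 (negPf hj) orbF => /eqP ->.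
by move/eqP; rewrite mulf_eq0 (negPf hj) orbF => /eqP ->.
Qed.

Lemma gradB u (q r : {mpoly R[n]}) : grad (q - r) u = grad q u - grad r u.
Proof. by apply/rowP => i; rewrite !mxE mderivB mevalB. Qed.

Lemma gradD u (q r : {mpoly R[n]}) : grad (q + r) u = grad q u + grad r u.
Proof. by apply/rowP => i; rewrite !mxE mderivD mevalD. Qed.

Lemma grad_lincomb u k (c : 'I_k -> R) (h : 'I_k -> {mpoly R[n]}) :
  grad (\sum_i c i *: h i) u = \sum_i c i *: grad (h i) u.
Proof.
apply/rowP => i; rewrite mxE summxE mderiv_sum meval_sum.
by apply: eq_bigr => j _; rewrite !mxE mderivZ mevalZ.
Qed.

Lemma grad_lagrangian u mu la : multipliers P u mu la ->
  grad (lagrangian P mu la) u = 0.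
Proof. by case=> gE _ _; rewrite gradB gradD !grad_lincomb gE subrr. Qed.

Lemma linear_form_grad u (q : {mpoly R[n]}) : linear_form u (grad q u) = linear_jet u q.
Proof. by apply: eq_bigr => i _; rewrite mxE. Qed.

Lemma hessian_sym u (q : {mpoly R[n]}) : (hessian q u)^T = hessian q u.
Proof. by apply/matrixP => i j; rewrite !mxE mderiv_comm. Qed.

Lemma gram_form (v l : 'rV[R]_n) : (v *m (l^T *m l) *m v^T) 0 0 = ((v *m l^T) 0 0) ^+ 2.
Proof.
rewrite mulmxA -mulmxA mxE big_ord1 expr2; congr (_ * _).
by rewrite -[v *m l^T]trmxK trmx_mul trmxK [RHS]mxE.
Qed.

(* Where [la > 0], the square root of [la - k d] to first order, [d] the differential of [g]:
   this trades the multiplier for the positive form [k d^2]. *)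
Lemma active_weight u (g : {mpoly R[n]}) (la k : R) : 0 < la -> g.@[u 0] = 0 ->
  exists t, vanish u 3 (la%:MP * g - t ^+ 2 * g - k%:MP * linear_jet u g ^+ 2).
Proof.
move=> la0 gu; pose a := Num.sqrt la; pose b := k / (2 * a).
have a0 : 0 < a by rewrite sqrtr_gt0.
exists (a%:MP - b%:MP * linear_jet u g).
have -> : la = a ^+ 2 by rewrite sqr_sqrtr // ltW.
have -> : k = 2%:R * a * b by rewrite /b; field; rewrite gt_eqF.
set d := linear_jet u g.
have -> : (a ^+ 2)%:MP * g - (a%:MP - b%:MP * d) ^+ 2 * g - (2%:R * a * b)%:MP * d ^+ 2 =
  (2%:R * (a%:MP * b%:MP)) * (d * (g - d)) - b%:MP ^+ 2 * (d * (d * g)).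
  by rewrite !mpolyCM mpolyC_nat; ring.
have ud : vanish u 1 d.
  by apply: vanish_sum => i _; apply: vanishMl; apply: vanish_shift.
have ug : vanish u 1 g by apply/vanish_root.
apply: vanishB; apply: vanishMl.
  apply: (@vanishM _ _ _ 1 2) => //.
  by have := taylor1 u g; rewrite gu mpolyC0 subr0.
by apply: (@vanishM _ _ _ 1 2) => //; apply: (@vanishM _ _ _ 1 1).
Qed.

(** To second order the Lagrangian is half its Hessian form. Finsler's lemma adds [k] times the
    squared active differentials; first order changes of the multipliers pay for them, with strict
    complementarity keeping the inequality weights squares. *)
Lemma optimality_certificate u : feasible P u -> optimality_conditions P u ->
  exists2 c : R, 0 < c & exists q r, QM (ineqs P) q /\
    vanish u 3 (objective P - ((objective P).@[u 0])%:MP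
      - (q + \sum_i r i * tnth (eqs P) i) - c%:MP * sqdist u).
Proof.
move=> fu [licq [mu0 [la0 [mult0 scc]]] [mu [la [mult sosc]]]].
have {mu0 la0 mult0}scc j : 0 < la j + (tnth (ineqs P) j).@[u 0].
  by rewrite -(multipliers_unique fu licq mult0 mult).
have [ue ug] := fu; have [gE la_ge0 laC] := mult.
pose L := lagrangian P mu la; pose H : 'M[R]_n := 2^-1 *: hessian L u.
(* This form vanishes exactly on the directions orthogonal to all active gradients, those covered by
   [SOSC]. *)
pose B : 'M[R]_n := \sum_(h <- active P u) (grad h u)^T *m grad h u.
have HB (v : 'rV[R]_n) : (v *m B *m v^T) 0 0 =
    \sum_(h <- active P u) ((v *m (grad h u)^T) 0 0) ^+ 2.
  rewrite mulmx_sumr mulmx_suml summxE; apply: eq_bigr => h _. exact: gram_form.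
have [v|v v0 Bv0|k k0 kP] := @finsler R n H B.
- by rewrite HB; apply: sumr_ge0 => h _; apply: sqr_ge0.
- rewrite -scalemxAr -scalemxAl mxE mulr_gt0 ?invr_gt0 //; apply: sosc => // h ha.
  move: Bv0; rewrite HB => /eqP; rewrite psumr_eq0 => [/allP/(_ h ha)|? _]; last exact: sqr_ge0.
  by rewrite sqrf_eq0 => /eqP.
have Bsym : B^T = B.
  by rewrite linear_sum; apply: eq_bigr => h _; rewrite /= trmx_mul trmxK.
have [||c c0 cP] := @PD_sqdist R n (H + k *: B).
- by rewrite linearD !linearZ /= hessian_sym Bsym.
- exact: kP.
have [s ss sE] := cP u.
have /choice[t tP] j : exists t, vanish u 3 ((la j)%:MP * tnth (ineqs P) j -
    t ^+ 2 * tnth (ineqs P) j - (if (tnth (ineqs P) j).@[u 0] == 0 then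
    k%:MP * linear_jet u (tnth (ineqs P) j) ^+ 2 else 0)).
  case: eqP => [gj|/eqP gj].
    by apply: active_weight => //; have := scc j; rewrite gj addr0.
  exists 0; have /eqP := laC j; rewrite mulf_eq0 (negPf gj) orbF => /eqP ->.
  by rewrite mpolyC0 expr0n mul0r !subr0; apply: vanish0.
exists c => //; exists (s + \sum_j tnth (ineqs P) j * t j ^+ 2).
(* With [d] the differential of a constraint [h], [k d h] is [k d^2] up to order 3: the perturbation
   yields the required squares. *)
exists (fun i => (mu i)%:MP - k%:MP * linear_jet u (tnth (eqs P) i)); split.
  apply: QMD; first exact: QM_sos.
  by apply: QM_sum => j _; apply/QM_gen/sos_sqr.
pose q := L - (L.@[u 0])%:MP.
have Lu : L.@[u 0] = (objective P).@[u 0].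
  rewrite mevalB mevalD !meval_sum !big1 ?addr0 ?subr0 // => i _; rewrite mevalZ.
    exact: laC.
  by rewrite ue mulr0.
have qu : vanish u 3 (q - quadratic_form u H).
  have -> : H = 2^-1 *: hessian q u.
    congr (_ *: _); apply/matrixP => i j; rewrite !mxE /q mderivB mderivC subr0 //.
  apply: taylor2; first by rewrite mevalB mevalC subrr.
  rewrite -(grad_lagrangian mult); apply/rowP => i.
  by rewrite !mxE /q mderivB mderivC subr0.
have qfB : k%:MP * quadratic_form u B = \sum_i k%:MP * linear_jet u (tnth (eqs P) i) ^+ 2 +
    \sum_j (if (tnth (ineqs P) j).@[u 0] == 0 then
      k%:MP * linear_jet u (tnth (ineqs P) j) ^+ 2 else 0).
  rewrite (big_morph _ (quadratic_formD u) (quadratic_form0 u)) mulr_sumr big_active //.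
  rewrite -[X in _ = _ + X]big_mkcond /=.
  by congr (_ + _); apply: eq_bigr => i _; rewrite quadratic_form_gram linear_form_grad.
have eqs_vanish : vanish u 3 (\sum_i k%:MP * (linear_jet u (tnth (eqs P) i) *
    (tnth (eqs P) i - linear_jet u (tnth (eqs P) i)))).
  apply: vanish_sum => i _; apply: vanishMl; apply: (@vanishM _ _ _ 1 2).
    by apply: vanish_sum => ? _; apply: vanishMl; apply: vanish_shift.
  by have := taylor1 u (tnth (eqs P) i); rewrite ue mpolyC0 subr0.
have ineqs_vanish := vanish_sum (index_enum 'I_m) (P := xpredT) (fun j _ => tP j).
have qfE : c%:MP * sqdist u = quadratic_form u H + k%:MP * quadratic_form u B - s.
  by rewrite -quadratic_formZ -quadratic_formD sE addrK.
have oE : objective P = L + (\sum_i mu i *: tnth (eqs P) i + \sum_j la j *: tnth (ineqs P) j).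
  by rewrite /L /lagrangian subrK.
rewrite [X in vanish u 3 (X - _ - _ - _)]oE qfE qfB.
have := vanishD qu (vanishD eqs_vanish ineqs_vanish); congr (vanish u 3 _).
rewrite /q Lu !sumrB.
have -> : \sum_i k%:MP * (linear_jet u (tnth (eqs P) i) *
      (tnth (eqs P) i - linear_jet u (tnth (eqs P) i))) =
    \sum_i k%:MP * linear_jet u (tnth (eqs P) i) * tnth (eqs P) i -
    \sum_i k%:MP * linear_jet u (tnth (eqs P) i) ^+ 2.
  by rewrite -sumrB; apply: eq_bigr => i _; ring.
have -> : \sum_i ((mu i)%:MP - k%:MP * linear_jet u (tnth (eqs P) i)) * tnth (eqs P) i =
    \sum_i mu i *: tnth (eqs P) i -
    \sum_i k%:MP * linear_jet u (tnth (eqs P) i) * tnth (eqs P) i.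
  by rewrite -sumrB; apply: eq_bigr => i _; rewrite -mul_mpolyC mulrBl.
have -> : \sum_j tnth (ineqs P) j * t j ^+ 2 = \sum_j t j ^+ 2 * tnth (ineqs P) j.
  by apply: eq_bigr => j _; rewrite mulrC.
under [X in _ = _ + (\sum_i mu i *: _ + X) - _ - _ - _]eq_bigr do rewrite -mul_mpolyC.
ring.
Qed.

End OptimalityConditions.

(** * Transfer of certificates to the homogenization *)

Lemma sos_comp (R : realType) (n k : nat) (p : {mpoly R[n]}) (y : n.-tuple {mpoly R[k]}) :
  sos p -> sos (p \mPo y).
Proof.
move=> [s ->]; exists [seq q \mPo y | q <- s].
by rewrite rmorph_sum big_map; apply: eq_bigr => q _; rewrite rmorphXn.
Qed.

Lemma vanish_comp (R : realType) (n k l : nat) (p : {mpoly R[n]})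
    (y : n.-tuple {mpoly R[k]}) (x : 'rV[R]_n) (z : 'rV[R]_k) :
  (forall i, (tnth y i).@[z 0] = x 0 i) -> vanish x l p -> vanish z l (p \mPo y).
Proof.
move=> yz; elim: l p => // l IH p [a [ax ->]]; rewrite rmorph_sum.
apply: vanish_sum => i _; rewrite /= rmorphM /= -addn1.
apply: vanishM; first exact: IH (ax i).
apply/vanish_root; rewrite comp_mpoly_meval.
by rewrite /shift mevalB mevalXU mevalC yz subrr.
Qed.

(* Stated with variables because [ring] would try to evaluate exponents such as [deg p]. *)
Section RingIdentities.
Variable T : comNzRingType.

Fact monomial_defect (c P q B W : T) :
  c * (P * q) - P * B * (c * (W * q)) = c * (P * q) * (1 - W * B).
Proof. ring. Qed.

Fact constraint_defect (q W W' X X' h : T) : q - W * W' * (X' * h) =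
  q * (1 - W * W' * (X * X')) - W * W' * X' * (h - X * q).
Proof. ring. Qed.

Fact weight_exchange (NK NE r r' g s : T) :
  NK * NE * (r' * (r * g) * s) = g * (NE * (r * r') * (NK * s)).
Proof. ring. Qed.

Fact conjugate_sum (g N a r b : T) :
  g * (N * (a + r * b)) + g * (N * (a + - r * b)) = 2%:R * (g * (N * a)).
Proof. ring. Qed.

End RingIdentities.

Section Transfer.
Variables (R : realType) (n : nat).
Implicit Types (p f : {mpoly R[n]}).

Local Notation X0 := ('X_ord0 : {mpoly R[n.+1]}).
Local Notation X1 i := ('X_(lift ord0 i) : {mpoly R[n.+1]}).

Variable z : 'rV[R]_n.+1.
Let a := z 0 ord0.
Hypotheses (a_neq0 : a != 0) (z_sphere : (sphere_eq R n.+1).@[z 0] = 0).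
Let x : 'rV[R]_n := \row_i (z 0 (lift ord0 i) / a).

(* The Taylor polynomial of [1 / x_0] at [z]: an inverse of [x_0] up to order 3. *)
Let t : {mpoly R[n.+1]} := 1 - (a^-1)%:MP * X0.
Let w : {mpoly R[n.+1]} := (a^-1)%:MP * (1 + t + t ^+ 2).
(** A polynomial substitute for the affine chart [x_i / x_0]. *)
Let y : n.-tuple {mpoly R[n.+1]} := [tuple w * X1 i | i < n].

Let wX0 : vanish z 3 (1 - w * X0).
Proof.
have tz : vanish z 1 t.
  by apply/vanish_root; rewrite mevalB meval1 mevalM mevalC mevalXU mulVf ?subrr.
have -> : 1 - w * X0 = t * (t * t) by rewrite /w /t; ring.
by apply: (@vanishM _ _ _ 1 2) => //; apply: (@vanishM _ _ _ 1 1).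
Qed.

Let wX0_pow k : vanish z 3 (1 - (w * X0) ^+ k).
Proof.
rewrite -opprB subrX1; apply: vanishN; apply: vanishMr.
by rewrite -opprB; apply: vanishN.
Qed.

Let wz : w.@[z 0] = a^-1.
Proof.
have tz : t.@[z 0] = 0.
  by rewrite mevalB meval1 mevalM mevalC mevalXU mulVf ?subrr.
rewrite mevalM mevalC (mevalD _ _ (t ^+ 2)) (mevalD _ 1 t) meval1 rmorphXn /= tz.
by rewrite expr2 mulr0 !addr0 mulr1.
Qed.

Let yz i : (tnth y i).@[z 0] = x 0 i.
Proof. by rewrite tnth_mktuple mevalM wz mevalXU mxE mulrC. Qed.

(** For each monomial [b] the defect is a multiple of [1 - (w x_0)^|b|], hence of order 3. *)
Let homogenize_comp p : vanish z 3 (homogenize p - X0 ^+ deg p * (p \mPo y)).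
Proof.
rewrite /homogenize comp_mpolyE mulr_sumr -sumrB big_seq.
apply: vanish_sum => b /msize_mdeg_lt b_lt.
have b_le : (mdeg b <= deg p)%N by rewrite /deg; case: (msize p) b_lt.
have -> : \prod_i tnth y i ^+ b i = w ^+ mdeg b * \prod_i X1 i ^+ b i.
  under eq_bigr do rewrite tnth_mktuple exprMn.
  by rewrite big_split /= prodrXr mdegE.
have -> : X0 ^+ deg p = X0 ^+ (deg p - mdeg b) * X0 ^+ mdeg b.
  by rewrite -exprD subnK.
move: (\prod_i _) => q; rewrite -!mul_mpolyC.
have -> : (p@_b)%:MP * (X0 ^+ (deg p - mdeg b) * q) -
    X0 ^+ (deg p - mdeg b) * X0 ^+ mdeg b * ((p@_b)%:MP * (w ^+ mdeg b * q)) =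
    (p@_b)%:MP * (X0 ^+ (deg p - mdeg b) * q) * (1 - (w * X0) ^+ mdeg b).
  rewrite [(w * X0) ^+ _]exprMn; exact: monomial_defect.
exact: vanishMl.
Qed.

Variables (m : nat) (g : m.-tuple {mpoly R[n]}) (e : 'I_m -> nat) (f : {mpoly R[n]}).
Hypotheses (f_even : ~~ odd (deg f)).
Hypotheses (g_even : forall j, ~~ odd (deg (tnth g j) + e j)).

(** The weights are chosen to make all degrees even, so that for [x_0 != 0] a constraint has the
    sign of [g_j(x / x_0)]: they are 0 in part (i) and [deg g_j] in part (ii). *)
Definition weighted_homogenization : m.-tuple {mpoly R[n.+1]} :=
  [tuple 'X_ord0 ^+ e j * homogenize (tnth g j) | j < m].
Local Notation G := weighted_homogenization.

(** The exponent of [w] is even, so this factor is a square and can be absorbed in the multiplier of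
    the constraint. *)
Let comp_ineq j : vanish z 3 (tnth g j \mPo y - w ^+ (deg (tnth g j) + e j) * tnth G j).
Proof.
rewrite tnth_mktuple; set D := deg _; set h := homogenize _; set q := _ \mPo _.
have -> : q - w ^+ (D + e j) * (X0 ^+ e j * h) =
  q * (1 - (w * X0) ^+ (D + e j)) - w ^+ (D + e j) * X0 ^+ e j * (h - X0 ^+ D * q).
  rewrite [(w * X0) ^+ _]exprMn !exprD; exact: constraint_defect.
by apply: vanishB; apply: vanishMl; [exact: wX0_pow|exact: homogenize_comp].
Qed.

Let even_sos (q : {mpoly R[n.+1]}) k : ~~ odd k -> sos (q ^+ k).
Proof. by move=> /even_halfK <-; rewrite -mul2n mulnC exprM; apply: sos_sqr. Qed.

(** These linear forms cut out the line through [z], the direction lost in the affine chart; [l i]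
    is the coefficient vector of [r i]. *)
Let r i : {mpoly R[n.+1]} := X1 i - (x 0 i)%:MP * X0.
Let l i : 'rV[R]_n.+1 := delta_mx 0 (lift ord0 i) - x 0 i *: delta_mx 0 ord0.

Let linear_form_delta i : linear_form z (delta_mx 0 i) = shift z i.
Proof.
rewrite /linear_form (bigD1 i) //= big1 => [|j ji].
  by rewrite mxE !eqxx mpolyC1 mul1r addr0.
by rewrite mxE (negPf ji) andbF mpolyC0 mul0r.
Qed.

Let r_linear i : r i = linear_form z (l i).
Proof.
have -> : linear_form z (l i) = linear_form z (delta_mx 0 (lift ord0 i))
    - (x 0 i)%:MP * linear_form z (delta_mx 0 ord0).
  rewrite /linear_form mulr_sumr -sumrB; apply: eq_bigr => j _.
  have -> : l i 0 j = (delta_mx 0 (lift ord0 i) : 'rV_n.+1) 0 j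
      - x 0 i * (delta_mx 0 ord0 : 'rV_n.+1) 0 j by rewrite /l !mxE.
  by rewrite mpolyCB mpolyCM mulrBl mulrA.
rewrite !linear_form_delta /r /shift.
have -> : (z 0 (lift ord0 i))%:MP = (x 0 i)%:MP * (z 0 ord0)%:MP :> {mpoly R[n.+1]}.
  by rewrite -mpolyCM mxE divfK.
by ring.
Qed.

Let sphere_linear : sphere_eq R n.+1 = linear_form z (2 *: z) + sqdist z.
Proof.
have z1 : \sum_i (z 0 i)%:MP ^+ 2 = 1 :> {mpoly R[n.+1]}.
  under eq_bigr do rewrite -rmorphXn; rewrite -rmorph_sum /= -mpolyC1; congr _%:MP.
  move/eqP: z_sphere; rewrite mevalB meval1 sqnorm_eval subr_eq0 => /eqP //.
rewrite /sphere_eq /sqnorm -z1 -sumrB -big_split; apply: eq_bigr => i _ /=.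
by rewrite mxE mpolyCM mpolyC_nat /shift; ring.
Qed.

(** Composing with [y] and multiplying by [x_0^d] transports the affine certificate, but its
    quadratic part degenerates along [z]. The square of the sphere equation, which lies in the
    ideal, supplies positivity in that direction. *)
Lemma affine_certificate (c gam : R) q : 0 < c -> QM g q ->
  vanish x 3 (f - gam%:MP - q - c%:MP * sqdist x) ->
  local_certificate (sphere_QM G) (homogenize f - gam *: X0 ^+ deg f) z.
Proof.
move=> c0 [s0 [s [ss0 ss ->]]] /(vanish_comp yz).
set d := deg f => fx.
pose m1 := X0 ^+ d * (s0 \mPo y) +
  \sum_j tnth G j * (X0 ^+ d * w ^+ (deg (tnth g j) + e j) * (s j \mPo y)).
have Gm1 : QM G m1.
  apply: QMD; first by apply/QM_sos/sosM; [exact: even_sos|exact: sos_comp].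
  apply: QM_sum => j _; apply/QM_gen/sosM; last exact: sos_comp.
  by apply: sosM; apply: even_sos.
(* The value at [z] of the factor [c x_0^d w^2] that multiplies the squares of the [r i]. *)
pose b := c * (a ^+ d / a ^+ 2).
have ad_gt0 : 0 < a ^+ d.
  rewrite -(even_halfK (f_even : ~~ odd d)) -mul2n exprM exprn_gt0 // lt_def sqr_ge0 andbT.
  by rewrite sqrf_eq0.
have b0 : 0 < b by rewrite mulr_gt0 // divr_gt0 // lt_def sqr_ge0 andbT sqrf_eq0.
pose H : 'M[R]_n.+1 := b *: (\sum_i (l i)^T *m l i) + (2 *: z)^T *m (2 *: z).
have HE (v : 'rV[R]_n.+1) : (v *m H *m v^T) 0 0 =
    b * (\sum_i ((v *m (l i)^T) 0 0) ^+ 2) + ((v *m (2 *: z)^T) 0 0) ^+ 2.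
  rewrite mulmxDr mulmxDl -scalemxAr -scalemxAl [LHS]mxE gram_form; congr (_ + _).
  rewrite [LHS]mxE; congr (_ * _); rewrite mulmx_sumr mulmx_suml summxE.
  by apply: eq_bigr => i _; apply: gram_form.
have [||c1 c10 cP] := @PD_sqdist R n.+1 H.
- rewrite linearD linearZ /= linear_sum /= trmx_mul trmxK; congr (_ *: _ + _).
  by apply: eq_bigr => i _; rewrite trmx_mul trmxK.
(* If the form vanishes at [v], the [l i] force [v] to be a multiple of [z], and orthogonality to
   [z] forces it to be 0. *)
- move=> v v0; rewrite HE.
  have bl_ge0 : 0 <= b * (\sum_i ((v *m (l i)^T) 0 0) ^+ 2).
    by apply: mulr_ge0; [exact: ltW|apply: sumr_ge0 => i _; apply: sqr_ge0].
  rewrite lt_def addr_ge0 ?sqr_ge0 // andbT.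
  apply: contra_neq v0 => /eqP; rewrite paddr_eq0 ?sqr_ge0 //.
  rewrite mulf_eq0 (gt_eqF b0) /= psumr_eq0 => [|i _]; last exact: sqr_ge0.
  rewrite sqrf_eq0 => /andP[/allP vl /eqP vz].
  have {vl} vi i : v 0 (lift ord0 i) = x 0 i * v 0 ord0.
    have := vl i (mem_index_enum i); rewrite sqrf_eq0 /l linearB linearZ /= mulmxBr.
    rewrite -scalemxAr !trmx_delta -!colE !mxE subr_eq0 => /eqP //.
  have vE : v = (v 0 ord0 / a) *: z.
    apply/rowP => i; rewrite mxE; case: (unliftP ord0 i) => [k ->|->].
      by rewrite vi mxE mulrC mulrA mulrAC.
    by rewrite divfK.
  have vzE : (v *m (2 *: z)^T) 0 0 = v 0 ord0 / a * 2.
    rewrite mxE (eq_bigr (fun i => v 0 ord0 / a * 2 * z 0 i ^+ 2)) => [|i _].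
      move: z_sphere; rewrite mevalB meval1 sqnorm_eval => /eqP.
      by rewrite subr_eq0 -mulr_sumr => /eqP ->; rewrite mulr1.
    by rewrite {1}vE !mxE; move: (v 0 ord0 / a) => k; ring.
  have : v 0 ord0 / a = 0.
    by move/eqP: vz; rewrite vzE mulf_eq0 pnatr_eq0 orbF => /eqP.
  by move=> va; rewrite vE va scale0r.
have [s1 ss1 sE] := cP z.
(* Subtracting the square of the sphere equation cancels, up to order 3, the square of the form
   [2 z] that was added in [H]. *)
exists c1 => //; exists (m1 + s1 + - sphere_eq R n.+1 * sphere_eq R n.+1).
  apply: sphere_QMD; last exact: sphere_QM_eq.
  by apply: sphere_QM_QM; apply: QMD => //; apply: QM_sos.
have HqE : c1%:MP * sqdist z = b%:MP * (\sum_i r i ^+ 2) + linear_form z (2 *: z) ^+ 2 - s1.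
  apply/eqP; rewrite eq_sym subr_eq -sE; apply/eqP.
  rewrite quadratic_formD quadratic_formZ quadratic_form_gram; congr (_ * _ + _).
  rewrite (big_morph _ (quadratic_formD z) (quadratic_form0 z)).
  by apply: eq_bigr => i _; rewrite quadratic_form_gram r_linear.
have rz i : vanish z 1 (r i).
  by rewrite r_linear; apply: vanish_sum => j _; apply: vanishMl; apply: vanish_shift.
have distE : vanish z 3 (X0 ^+ d * c%:MP * (sqdist x \mPo y) - b%:MP * \sum_i r i ^+ 2).
  rewrite rmorph_sum !mulr_sumr -sumrB; apply: vanish_sum => i _ /=.
  rewrite rmorphXn /=; set u := _ \mPo y.
  have uE : u = w * r i - (x 0 i)%:MP * (1 - w * X0).
    rewrite /u /shift comp_mpolyB comp_mpolyC comp_mpolyXU -tnth_nth tnth_mktuple /r.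
    by ring.
  have -> : X0 ^+ d * c%:MP * u ^+ 2 - b%:MP * r i ^+ 2 =
    (X0 ^+ d * c%:MP * w ^+ 2 - b%:MP) * (r i * r i) -
    X0 ^+ d * c%:MP * (x 0 i)%:MP * (w * r i + u) * (1 - w * X0).
    by rewrite uE; move: (X0 ^+ d) => A; ring.
  apply: vanishB; last exact: vanishMl.
  apply: (@vanishM _ _ _ 1 2); last by apply: (@vanishM _ _ _ 1 1).
  have w2z : (w ^+ 2).@[z 0] = a^-1 ^+ 2 by rewrite rmorphXn /= wz.
  apply/vanish_root; rewrite mevalB (mevalM _ _ (w ^+ 2)) w2z mevalM rmorphXn /= mevalXU !mevalC.
  by rewrite -/a /b exprVn mulrA [c * _]mulrC subrr.
have ineqE : vanish z 3 (X0 ^+ d * ((s0 + \sum_j tnth g j * s j) \mPo y) - m1).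
  rewrite comp_mpolyD mulrDr /m1 opprD addrACA subrr add0r rmorph_sum mulr_sumr -sumrB.
  apply: vanish_sum => j _; rewrite rmorphM /=.
  set v' := s j \mPo y; set v := _ \mPo y; set D := (_ + e j)%N.
  have -> : X0 ^+ d * (v * v') - tnth G j * (X0 ^+ d * w ^+ D * v') =
    X0 ^+ d * v' * (v - w ^+ D * tnth G j).
    by move: (X0 ^+ d) (w ^+ D) => A B; ring.
  by apply: vanishMl; apply: comp_ineq.
have objE := homogenize_comp f.
move: fx; rewrite !comp_mpolyB rmorphM /= !comp_mpolyC => fx.
have sphere_sq : vanish z 3 (sphere_eq R n.+1 * sphere_eq R n.+1 - linear_form z (2 *: z) ^+ 2).
  rewrite sphere_linear; set lz := linear_form _ _.
  have -> : (lz + sqdist z) * (lz + sqdist z) - lz ^+ 2 = (lz + lz + sqdist z) * sqdist z by ring.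
  have vs := vanish_sqdist z.
  apply: (@vanishM _ _ _ 1 2) => //; apply: vanishD; last exact: vanishW.
  have : vanish z 1 lz by apply: vanish_sum => j _; apply: vanishMl; apply: vanish_shift.
  by move=> vl; apply: vanishD.
have := vanishD (vanishD (vanishD objE (vanishMl (X0 ^+ d) fx)) (vanishD ineqE distE)) sphere_sq.
rewrite HqE -mul_mpolyC; congr (vanish z 3 _).
rewrite -/d; move: (X0 ^+ d) => A; ring.
Qed.

End Transfer.

(** * Dehomogenization *)

Section Dehomogenization.
Variables (R : realType) (n : nat).
Implicit Types (x : 'rV[R]_n) (r : R) (q : {mpoly R[n.+1]}).

Definition sqradius : {mpoly R[n]} := 1 + sqnorm R n.
Local Notation N := sqradius.

Lemma N_eval x : N.@[x 0] = 1 + \sum_i x 0 i ^+ 2.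
Proof. by rewrite mevalD meval1 sqnorm_eval. Qed.

Lemma N_gt0 x : 0 < N.@[x 0].
Proof. by rewrite N_eval ltr_pwDl // sumr_ge0 // => i _; apply: sqr_ge0. Qed.

Lemma N_sos : sos N.
Proof. by apply: sosD; [exact: sos1|apply: sos_sum => i _; apply: sos_sqr]. Qed.

(* The points of the sphere above [x] are [(1, x) / r] with [r^2 = 1 + |x|^2]. *)
Definition sphere_point x r : 'rV[R]_n.+1 := hpt r^-1 (r^-1 *: x).

Lemma radius_neq0 x r : r ^+ 2 = N.@[x 0] -> r != 0.
Proof. by move=> rN; rewrite -sqrf_eq0 rN gt_eqF // N_gt0. Qed.

Lemma sphere_point_eq x r : r ^+ 2 = N.@[x 0] -> (sphere_eq R n.+1).@[sphere_point x r 0] = 0.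
Proof.
move=> rN; have r0 := radius_neq0 rN.
rewrite mevalB meval1 sqnorm_eval big_ord_recl hpt0.
under eq_bigr do rewrite hptS mxE exprMn.
rewrite -mulr_sumr; set S := \sum_i _.
have -> : r^-1 ^+ 2 + r^-1 ^+ 2 * S = (r^-1 * r) ^+ 2.
  by rewrite exprMn rN N_eval mulrDr mulr1.
by rewrite mulVf // expr1n subrr.
Qed.

Lemma sphere_point_homogenize x r (p : {mpoly R[n]}) : r != 0 ->
  (homogenize p).@[sphere_point x r 0] = r^-1 ^+ deg p * p.@[x 0].
Proof.
move=> r0; rewrite homogenizeE ?invr_eq0 //; congr (_ * _.@[_ 0]).
by rewrite invrK scalerA mulfV // scale1r.
Qed.

(** After clearing the denominator [r^K], values on the sphere lie in [R[x] + r R[x]], with the same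
    [A] and [B] for both signs of [r]. *)
Definition representable (K : nat) q := exists A B : {mpoly R[n]},
  forall x r, r ^+ 2 = N.@[x 0] -> r ^+ K * q.@[sphere_point x r 0] = A.@[x 0] + r * B.@[x 0].

Lemma representable_leq K L q : (K <= L)%N -> representable K q -> representable L q.
Proof.
move=> /subnK <-; elim: (L - K)%N => //= k IH /IH[A [B AB]].
exists (N * B), A => x r rN; rewrite exprS -mulrA AB // mevalM -rN; ring.
Qed.

Lemma representable_ex q : exists K, representable K q.
Proof.
elim/mpoly_ind_ring: q => [c|p q [K pK] [L qL]|i q [K [A [B AB]]]].
- by exists 0%N, c%:MP, 0 => x r _; rewrite ?mevalC ?meval0 expr0 mul1r mulr0 addr0.
- have [A [B AB]] := representable_leq (leq_maxl K L) pK.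
  have [A' [B' AB']] := representable_leq (leq_maxr K L) qL.
  exists (maxn K L), (A + A'), (B + B') => x r rN.
  by rewrite mevalD mulrDr AB // AB' // !mevalD; ring.
- pose v : {mpoly R[n]} := if unlift ord0 i is Some k then 'X_k else 1.
  exists K.+1, (v * A), (v * B) => x r rN; rewrite mevalM mevalXU exprS.
  have r0 := radius_neq0 rN.
  have vE : r * sphere_point x r 0 i = v.@[x 0].
    rewrite /v; case: unliftP => [k ->|->].
      by rewrite hptS mxE mevalXU mulVKf.
    by rewrite hpt0 meval1 mulfV.
  by rewrite mulrACA vE AB // !mevalM; ring.
Qed.

(** For one square, [N^K p^2 = (r^K p)^2 = (A + r B)^2], whose part free of [r] is the sum of
    squares [A^2 + N B^2]. *)
Lemma representable_sos q : sos q -> exists K0, forall K, (K0 <= K)%N ->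
  exists A B : {mpoly R[n]}, sos A /\ forall x r, r ^+ 2 = N.@[x 0] ->
    N.@[x 0] ^+ K * q.@[sphere_point x r 0] = A.@[x 0] + r * B.@[x 0].
Proof.
move=> [s ->]; elim: s => [|p s [K0 IH]].
  exists 0%N => K _; exists 0, 0; split; first exact: sos0.
  by move=> x r _; rewrite big_nil !meval0 !mulr0 addr0.
have [K1 pK1] := representable_ex p.
exists (maxn K0 K1) => K; rewrite geq_max => /andP[/IH[A [B [sA AB]]] K1K].
have [A' [B' AB']] := representable_leq K1K pK1.
exists (A' ^+ 2 + N * B' ^+ 2 + A), (2%:R * A' * B' + B); split.
  apply: sosD => //; apply: sosD; first exact: sos_sqr.
  by apply: sosM; [exact: N_sos|exact: sos_sqr].
move=> x r rN; rewrite big_cons (mevalD _ (p ^+ 2)) mulrDr AB // rmorphXn /=.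
rewrite -{1}rN -exprM mulnC exprM -exprMn AB' //.
rewrite (mevalD _ _ A) (mevalD _ (A' ^+ 2)) (mevalM _ N) -rN (mevalD _ _ B) !mevalM.
rewrite rmorph_nat /=; ring.
Qed.

(** Evaluation at the two points of the sphere over [x] and averaging cancels the terms odd in [r];
    even degrees turn the remaining powers of [r] into powers of [N]. *)
Lemma dehomogenize m (g : m.-tuple {mpoly R[n]}) (e : 'I_m -> nat) (f : {mpoly R[n]}) (gam : R) :
  ~~ odd (deg f) -> (forall j, ~~ odd (deg (tnth g j) + e j)) ->
  sphere_QM (weighted_homogenization g e) (homogenize f - gam *: 'X_ord0 ^+ deg f) ->
  exists k, QM g (N ^+ k * (f - gam%:MP)).
Proof.
move=> f_even g_even [_ [phi [[s0 [s [ss0 ss ->]]] FE]]].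
pose dj j := (deg (tnth g j) + e j)./2; pose d := (deg f)./2.
have djE j : (deg (tnth g j) + e j = dj j * 2)%N by rewrite muln2 even_halfK.
have dE : (deg f = d * 2)%N by rewrite muln2 even_halfK.
have [K0 s0K] := representable_sos ss0.
have [K1 sK] := @eventually_all _ (enum 'I_m) (fun j K => exists A B : {mpoly R[n]},
  sos A /\ forall x r, r ^+ 2 = N.@[x 0] ->
    N.@[x 0] ^+ K * (s j).@[sphere_point x r 0] = A.@[x 0] + r * B.@[x 0])
  (fun j _ => representable_sos (ss j)).
pose K := maxn K0 K1.
have [A0 [B0 AB0]] := s0K K (leq_maxl _ _).
have /choice[A AP] j : exists A, exists B : {mpoly R[n]}, sos A /\
    forall x r, r ^+ 2 = N.@[x 0] ->
      N.@[x 0] ^+ K * (s j).@[sphere_point x r 0] = A.@[x 0] + r * B.@[x 0].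
  by apply: sK; [exact: leq_maxr|exact: mem_enum].
have {AP}/choice[B AB] := AP.
(* At least the half degree of [f] and of each weighted constraint, so [N^E] clears all these
   denominators. *)
pose E := (d + \sum_j dj j)%N.
have djE' j : (dj j <= E)%N by rewrite /E (bigD1 j) //= addnCA leq_addr.
exists (K + (E - d))%N.
have -> : N ^+ (K + (E - d)) * (f - gam%:MP) =
    N ^+ E * A0 + \sum_j tnth g j * (N ^+ (E - dj j) * A j).
  apply: meval_inj => x; pose r := Num.sqrt N.@[x 0].
  have rN : r ^+ 2 = N.@[x 0] by rewrite sqr_sqrtr // ltW // N_gt0.
  have Nx0 : N.@[x 0] != 0 by rewrite gt_eqF // N_gt0.
  have main r' : r' ^+ 2 = N.@[x 0] ->
      N.@[x 0] ^+ (K + (E - d)) * (f.@[x 0] - gam) =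
      N.@[x 0] ^+ E * (A0.@[x 0] + r' * B0.@[x 0]) +
      \sum_j (tnth g j).@[x 0] * (N.@[x 0] ^+ (E - dj j) * ((A j).@[x 0] + r' * (B j).@[x 0])).
    move=> r'N; have r'0 := radius_neq0 r'N.
    have powN k l : (k <= l)%N -> N.@[x 0] ^+ (l - k) = N.@[x 0] ^+ l * r'^-1 ^+ (k * 2).
      move=> kl; rewrite mulnC exprM exprVn r'N exprVn -[in RHS](subnK kl) exprD.
      by rewrite mulfK // expf_neq0.
    have := congr1 (fun q => N.@[x 0] ^+ (K + E) * q.@[sphere_point x r' 0]) FE.
    rewrite mevalB mevalZ rmorphXn /= mevalXU hpt0 sphere_point_homogenize //.
    rewrite (mevalD _ _ (phi * _)) (mevalD _ s0) (mevalM _ phi).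
    rewrite sphere_point_eq // mulr0 addr0 dE meval_sum.
    rewrite addnBA; last exact: leq_addr.
    rewrite powN; last by rewrite /E; lia.
    move=> H.
    transitivity (N.@[x 0] ^+ (K + E) * (r'^-1 ^+ (d * 2) * f.@[x 0] - gam * r'^-1 ^+ (d * 2))).
      by rewrite -mulrA mulrBr [_ * gam]mulrC.
    rewrite H mulrDr exprD -mulrA mulrCA (proj2 AB0) //; congr (_ + _).
    rewrite mulr_sumr; apply: eq_bigr => j _; rewrite mevalM tnth_mktuple mevalM rmorphXn /=.
    rewrite mevalXU hpt0 sphere_point_homogenize // -(proj2 (AB j)) // powN // -djE.
    rewrite !exprD; exact: weight_exchange.
  rewrite (mevalM _ _ (f - _)) (mevalB _ f) mevalC rmorphXn /=.
  rewrite (mevalD _ (N ^+ E * A0)) (mevalM _ _ A0) rmorphXn /= meval_sum.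
  have m1 := main r rN; have m2 := main (- r) (etrans (sqrrN r) rN).
  have two0 : 2 != 0 :> R by rewrite pnatr_eq0.
  apply: (mulfI two0); rewrite mulr_natl mulr2n {1}m1 m2 addrACA -big_split /=.
  rewrite [RHS]mulrDr [X in _ = _ + X]mulr_sumr; congr (_ + _).
    by have := conjugate_sum 1 (N.@[x 0] ^+ E) A0.@[x 0] r B0.@[x 0]; rewrite !mul1r.
  apply: eq_bigr => j _; rewrite mevalM (mevalM _ _ (A j)) rmorphXn /=; exact: conjugate_sum.
apply: QMD; first by apply/QM_sos/sosM; [apply/sosX/N_sos|case: AB0].
by apply: QM_sum => j _; apply/QM_gen/sosM; [apply/sosX/N_sos|case: (AB j)].
Qed.

End Dehomogenization.

(** * The two parts of the theorem *)

Section Assembly.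
Variables (R : realType) (n m : nat) (g : m.-tuple {mpoly R[n]}) (f : {mpoly R[n]}).
Hypothesis f_ge0 : forall x : 'rV[R]_n, basic_semialg g x -> 0 <= f.@[x 0].
Implicit Types (x : 'rV[R]_n) (z : 'rV[R]_n.+1).

Lemma fmin_le x : basic_semialg g x -> fmin f g <= f.@[x 0].
Proof.
move=> gx; apply: ge_inf; last by exists x.
by exists 0 => _ [y gy <-]; apply: f_ge0.
Qed.

Lemma fmin_ge0 : 0 <= fmin f g.
Proof.
have [[x gx]|g0] := pselect (basic_semialg g !=set0).
  apply: lb_le_inf; first by exists f.@[x 0], x.
  by move=> _ [y gy <-]; apply: f_ge0.
(* For an empty feasible set [inf] is 0 by convention. *)
rewrite /fmin (_ : [set _ | _ in _] = set0) ?inf0 //.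
by apply/seteqP; split=> // t [y gy _]; case: g0; exists y.
Qed.

Definition infinite_part z : 'rV[R]_n := \row_i z 0 (lift ord0 i).
Definition affine_part z : 'rV[R]_n := \row_i (z 0 (lift ord0 i) / z 0 ord0).

Lemma hpt_infinite_part z : z = hpt (z 0 ord0) (infinite_part z).
Proof.
apply/rowP => i; case: (unliftP ord0 i) => [k ->|->]; last by rewrite hpt0.
by rewrite hptS mxE.
Qed.

Lemma homogenize_affine_part z (p : {mpoly R[n]}) : z 0 ord0 != 0 ->
  (homogenize p).@[z 0] = z 0 ord0 ^+ deg p * p.@[affine_part z 0].
Proof.
move=> z0; rewrite [in LHS](hpt_infinite_part z) homogenizeE //.
by congr (_ * _); apply: meval_eq => i; rewrite !mxE mulrC.
Qed.

Definition objective_hom : {mpoly R[n.+1]} := homogenize f - fmin f g *: 'X_ord0 ^+ deg f.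

Lemma objective_hom_eval z : objective_hom.@[z 0] =
  (homogenize f).@[z 0] - fmin f g * z 0 ord0 ^+ deg f.
Proof. by rewrite mevalB mevalZ rmorphXn /= mevalXU. Qed.

Lemma objective_hom_affine z : z 0 ord0 != 0 ->
  objective_hom.@[z 0] = z 0 ord0 ^+ deg f * (f.@[affine_part z 0] - fmin f g).
Proof.
by move=> z0; rewrite objective_hom_eval homogenize_affine_part // mulrBr [_ * fmin f g]mulrC.
Qed.

Lemma even_exp_gt0 (a : R) k : a != 0 -> ~~ odd k -> 0 < a ^+ k.
Proof.
move=> a0 /even_halfK <-; rewrite -mul2n exprM exprn_gt0 // lt_def sqr_ge0 andbT.
by rewrite sqrf_eq0.
Qed.

Section EvenWeights.
Variable e : 'I_m -> nat.
Hypotheses (f_even : ~~ odd (deg f)) (g_even : forall j, ~~ odd (deg (tnth g j) + e j)).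
Local Notation G := (weighted_homogenization g e).

Lemma affine_part_feasible z : z 0 ord0 != 0 -> basic_semialg G z ->
  basic_semialg g (affine_part z).
Proof.
move=> z0 Gz j; have := Gz j; rewrite tnth_mktuple mevalM rmorphXn /= mevalXU.
rewrite homogenize_affine_part // mulrA -exprD addnC pmulr_rge0 //.
exact: even_exp_gt0.
Qed.

(** The two parts of the theorem differ only in how they treat the points with [x_0 = 0] and in the
    weights. *)
Hypothesis infinity : forall z, sphere_semialg G z -> z 0 ord0 = 0 ->
  0 <= objective_hom.@[z 0] /\
  (objective_hom.@[z 0] = 0 -> local_certificate (sphere_QM G) objective_hom z).
Hypothesis affine_opt : forall x, minimizer (problemQ f g) x ->
  optimality_conditions (problemQ f g) x.

Lemma even_weights_certificate : exists k, QM g ((1 + sqnorm R n) ^+ k * f).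
Proof.
suff /dehomogenize[//|//|k kP] : sphere_QM G objective_hom.
  (* The certificate is for [f - fmin]; the constant [fmin >= 0] is added back as a sum of
     squares. *)
  exists k; rewrite -[f](subrK (fmin f g)%:MP) mulrDr; apply: QMD => //.
  apply/QM_sos/sosM; last exact/sosC/fmin_ge0.
  exact/sosX/N_sos.
apply: (@local_global R _ (sphere_semialg G)).
- exact: sphere_semialg_compact.
- exact: sphere_QMD.
- exact: sphere_QM_sosM.
- by move=> p z; apply: sphere_QM_ge0.
- exact: putinar_sphere.
- move=> z Kz; have [z0|z0] := eqVneq (z 0 ord0) 0; first by case: (infinity Kz z0).
  rewrite objective_hom_affine // pmulr_rge0 ?even_exp_gt0 // subr_ge0.
  by apply/fmin_le/affine_part_feasible => //; case: Kz.
- move=> z Kz Fz; have [z0|z0] := eqVneq (z 0 ord0) 0; first by case: (infinity Kz z0) => _; apply.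
  have gx : basic_semialg g (affine_part z) by apply: affine_part_feasible => //; case: Kz.
  have fx : f.@[affine_part z 0] = fmin f g.
    move/eqP: Fz; rewrite objective_hom_affine // mulf_eq0 subr_eq0.
    by rewrite gt_eqF ?even_exp_gt0 //= => /eqP.
  have min_x : minimizer (problemQ f g) (affine_part z).
    split=> [|y [_ gy]]; last by rewrite /= fx fmin_le.
    by split=> // -[].
  have [c c0 [q [r [gq]]]] := optimality_certificate min_x.1 (affine_opt min_x).
  rewrite big_ord0 addr0 /= fx => qP.
  by apply: affine_certificate c0 gq qP => //; case: Kz.
Qed.

End EvenWeights.

Lemma weighted_homogenization0 : weighted_homogenization g (fun=> 0%N) = homogenize_tuple g.
Proof. by apply: eq_from_tnth => j; rewrite !tnth_mktuple expr0 mul1r. Qed.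

Lemma sphere_enorm z : (sphere_eq R n.+1).@[z 0] = 0 -> enorm z = 1.
Proof.
rewrite mevalB meval1 sqnorm_eval /enorm => /eqP.
by rewrite subr_eq0 => /eqP ->; rewrite sqrtr1.
Qed.

(** Nonnegativity at infinity passes to the limit from points with [x_0 > 0], by closedness. A zero
    there is a minimizer at infinity, and [optimality_certificate] for the homogenized problem
    applies directly. *)
Lemma closed_at_infinity_certificate : closed_at_infinity g ->
  ~~ odd (deg f) -> (forall j, ~~ odd (deg (tnth g j))) ->
  (forall x, minimizer (problemQ f g) x -> optimality_conditions (problemQ f g) x) ->
  (forall x, minimizer_at_infinity f g x ->
     optimality_conditions (homogenized_problem f g) (hpt 0 x)) ->
  exists k, QM g ((1 + sqnorm R n) ^+ k * f).
Proof.
move=> g_closed f_even g_even affine_opt infinite_opt.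
have g_even0 j : ~~ odd (deg (tnth g j) + 0) by rewrite addn0.
apply: (even_weights_certificate f_even g_even0) => // z [z_sphere Gz] z0.
have Fz : 0 <= objective_hom.@[z 0].
  have : closure (basic_semialg (homogenize_tuple g) `&` [set u | 0 < u 0 ord0]) z.
    by rewrite g_closed; split; [rewrite -weighted_homogenization0|rewrite /= z0].
  have closedF : closed [set u : 'rV[R]_n.+1 | 0 <= objective_hom.@[u 0]].
    exact: closed_meval_ge0.
  suff /closure_subset : basic_semialg (homogenize_tuple g) `&` [set u | 0 < u 0 ord0] `<=`
      [set u : 'rV[R]_n.+1 | 0 <= objective_hom.@[u 0]].
    by rewrite -((closure_id _).1 closedF); apply.
  move=> u [gu /= u0]; have uN0 : u 0 ord0 != 0 by rewrite gt_eqF.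
  rewrite objective_hom_affine // pmulr_rge0 ?exprn_gt0 // subr_ge0; apply: fmin_le.
  by apply: (affine_part_feasible g_even0) => //; rewrite weighted_homogenization0.
split=> // Fz0.
rewrite weighted_homogenization0 in Gz *.
have zE : z = hpt 0 (infinite_part z) by rewrite -z0 -hpt_infinite_part.
have inf_z : minimizer_at_infinity f g (infinite_part z).
  rewrite /minimizer_at_infinity -zE; split; first exact: sphere_enorm.
    by move=> j; have := Gz j; rewrite tnth_mktuple.
  by rewrite -objective_hom_eval.
have feas : feasible (homogenized_problem f g) z.
  by split=> [i|//]; rewrite ord1 (tnth_nth 0).
have := infinite_opt _ inf_z; rewrite -zE => /(optimality_certificate feas).
case=> c c0 [q [r [Gq]]]; rewrite /= big_ord1 (tnth_nth 0) /= -/objective_hom Fz0 mpolyC0 subr0.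
move=> qP; exists c => //; exists (q + r ord0 * sphere_eq R n.+1) => //.
by apply: sphere_QMD; [exact: sphere_QM_QM|exact: sphere_QM_eq].
Qed.

Lemma leading_form_eval x (p : {mpoly R[n]}) : (leading_form p).@[x 0] =
  \sum_(b <- msupp p | mdeg b == deg p) p@_b * \prod_i x 0 i ^+ b i.
Proof.
rewrite meval_sum; apply: eq_bigr => b _; by rewrite mevalZ mevalX.
Qed.

Lemma homogenize_infinity x (p : {mpoly R[n]}) :
  (homogenize p).@[hpt 0 x 0] = (leading_form p).@[x 0].
Proof.
rewrite leading_form_eval big_mkcond meval_sum /= big_seq [RHS]big_seq.
apply: eq_bigr => b /msize_mdeg_lt b_lt.
have b_le : (mdeg b <= deg p)%N by rewrite /deg; case: (msize p) b_lt.
rewrite mevalZ mevalM rmorphXn /= mevalXU hpt0 rmorph_prod /=.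
case: eqP => [->|/eqP b_deg]; last first.
  by rewrite expr0n subn_eq0 leqNgt ltn_neqAle b_deg b_le mul0r mulr0.
rewrite subnn expr0 mul1r; congr (_ * _); apply: eq_bigr => i _.
by rewrite rmorphXn /= mevalXU hptS.
Qed.

(** A form of odd degree changes sign between opposite points; for [n = 0] the polynomial is a
    constant. *)
Lemma positive_definite_even : positive_definite (leading_form f) -> ~~ odd (deg f).
Proof.
move=> pd.
have [n0|n0] := posnP n.
  have -> : f = (f@_0)%:MP.
    apply/mpolyP => b; have -> : b = 0%MM.
      by apply/mnmP => i; have := ltn_ord i; rewrite [X in (_ < X)%N]n0.
    by rewrite mcoeffC eqxx mulr1.
  by rewrite /deg msizeC; case: eqP.
have x0 : const_mx 1 != 0 :> 'rV[R]_n.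
  by apply/eqP => /rowP/(_ (Ordinal n0)); rewrite !mxE => /eqP; rewrite oner_eq0.
have lead_odd : odd (deg f) ->
    (leading_form f).@[(- const_mx 1 : 'rV[R]_n) 0] =
    - (leading_form f).@[(const_mx 1 : 'rV[R]_n) 0].
  move=> f_odd; rewrite !leading_form_eval -sumrN; apply: eq_bigr => b /eqP b_deg.
  under eq_bigr do rewrite !mxE.
  under [in RHS]eq_bigr do rewrite mxE expr1n.
  by rewrite prodrXr -mdegE b_deg -signr_odd f_odd big1 // mulrN1 mulr1.
apply/negP => /lead_odd lead_eq.
have := pd _ x0; have := pd (- const_mx 1); rewrite oppr_eq0 lead_eq => /(_ x0).
by rewrite oppr_gt0 => /ltW; rewrite leNgt => /negP.
Qed.

(** At infinity a nonconstant [f] has objective equal to its leading form, which is positive, so no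
    zeros arise there. *)
Lemma positive_definite_certificate : positive_definite (leading_form f) ->
  (forall x, minimizer (problemQ f g) x -> optimality_conditions (problemQ f g) x) ->
  exists k, QM g ((1 + sqnorm R n) ^+ k * f).
Proof.
move=> pd affine_opt.
have f_even := positive_definite_even pd.
have g_even j : ~~ odd (deg (tnth g j) + deg (tnth g j)) by rewrite addnn odd_double.
(* This sets aside constant [f]: then [x_0^0 = 1] even at infinity and the objective there need not
   be positive. *)
have [|f_neg] := pselect (sos f).
  by move=> f_sos; exists 0%N; rewrite expr0 mul1r; apply: QM_sos.
apply: (even_weights_certificate f_even g_even) => // z [/= z_sphere _] z0.
suff Fz : 0 < objective_hom.@[z 0].
  by split; [exact: ltW|move=> Fz0; rewrite Fz0 ltxx in Fz].
have zE : z = hpt 0 (infinite_part z) by rewrite -z0 -hpt_infinite_part.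
have zN0 : infinite_part z != 0.
  have := sphere_neq0 z_sphere; apply: contra_neq => iz.
  rewrite zE iz; apply/rowP => i; case: (unliftP ord0 i) => [k ->|->].
    by rewrite hptS !mxE.
  by rewrite hpt0 mxE.
have lead_pos := pd _ zN0.
rewrite objective_hom_eval z0 zE homogenize_infinity.
have [f0|f0] := posnP (deg f); last by rewrite expr0n gtn_eqF // mulr0 subr0.
case: f_neg; have [c fC] : exists c, f = c%:MP.
  by exists f@_0; apply: msize1_polyC; move: f0; rewrite /deg; case: (msize f) => [|[]].
rewrite fC; apply: sosC; move: lead_pos; rewrite leading_form_eval fC msuppC.
case: eqP => [-> _|_]; first exact: lexx.
rewrite big_cons big_nil mcoeffC eqxx mulr1 mdeg0.
rewrite big1 => [|i _]; last by rewrite mnm0E expr0.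
by case: ifP => _; rewrite ?ltxx // addr0 mulr1 => /ltW.
Qed.

End Assembly.

Theorem theorem5p3 (R : realType) (n m : nat) (g : m.-tuple {mpoly R[n]})
    (f : {mpoly R[n]})
    (f_ge0 : forall x : 'rV[R]_n, basic_semialg g x -> 0 <= f.@[x 0]) :
  (closed_at_infinity g ->
   ~~ odd (deg f) ->
   (forall j : 'I_m, ~~ odd (deg (tnth g j))) ->
   (forall x : 'rV[R]_n, minimizer (problemQ f g) x ->
      optimality_conditions (problemQ f g) x) ->
   (forall x : 'rV[R]_n, minimizer_at_infinity f g x ->
      optimality_conditions (homogenized_problem f g) (hpt 0 x)) ->
   exists k : nat, QM g ((1 + sqnorm R n) ^+ k * f))
  /\
  (positive_definite (leading_form f) ->
   (forall x : 'rV[R]_n, minimizer (problemQ f g) x ->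
      optimality_conditions (problemQ f g) x) ->
   exists k : nat, QM g ((1 + sqnorm R n) ^+ k * f)).
Proof.
split; first exact: closed_at_infinity_certificate.
exact: positive_definite_certificate.
Qed.
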